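(* Let $n\in\mathbb N\cup\{\infty\}$, let $k^i\ge0$ ($1\le i\le n$) satisfy $\sum_ie^{-k^i}\le1$, and let $T\ge1$. Consider FPL (Follow the Perturbed Leader) with independent randomization at each time step against an adaptive adversary, as defined in the context, with actual total loss $u_{1:T}=\sum_{t=1}^Tu_t$ and conditional expected losses $\ell_t$. Then for every adaptive adversary the following hold (all learning rates positive). (1) Static rates. (i) If $\eta_t=1/\sqrt L$ with a constant $L>0$ such that $L\ge\ell_{1:T}$ almost surely, then $E[u_{1:T}]\le E\big[s_{1:T}^i+\sqrt L(k^i+1)\big]$ for all $i$. (ii) If $\eta_t=\sqrt{K/L}$ with constants $L>0$, $K>0$ such that $L\ge\ell_{1:T}$ almost surely and $k^i\le K$ for all $i$, then $E[u_{1:T}]\le E\big[s_{1:T}^i+2\sqrt{LK}\big]$ for all $i$. (iii) For a fixed $i$ with $k^i>0$, if $\eta_t=\sqrt{k^i/L}$ with a constant $L$ such that $L\ge\max\{s_{1:T}^i,k^i\}$ almost surely, then $E[u_{1:T}]\le E\big[s_{1:T}^i+2\sqrt{Lk^i}+3k^i\big]$. (2) Rates depending on $t$. (i) If $\eta_t=1/\sqrt t$, then $E[u_{1:T}]\le E\big[s_{1:T}^i+\sqrt T(k^i+2)\big]$ for all $i$. (ii) If $\eta_t=\sqrt{K/(2t)}$ with $K>0$ and $k^i\le K$ for all $i$, then $E[u_{1:T}]\le E\big[s_{1:T}^i+2\sqrt{2TK}\big]$ for all $i$. (3) Self-confident rates. (i) If $\eta_t=1/\sqrt{2(\ell_{<t}+1)}$,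 then $E[u_{1:T}]\le E\big[s_{1:T}^i+(k^i+1)\sqrt{2(s_{1:T}^i+1)}+2(k^i+1)^2\big]$ for all $i$. (ii) If $\eta_t=\sqrt{K/(2(\ell_{<t}+1))}$ with $K>0$ and $k^i\le K$ for all $i$, then $E[u_{1:T}]\le E\big[s_{1:T}^i+2\sqrt{2(s_{1:T}^i+1)K}+8K\big]$ for all $i$. (4) Rates depending on the best past loss. (i) If $\eta_t=1/\min_i\{k^i+\sqrt{(k^i)^2+2s_{<t}^i+2}\}$, then $E[u_{1:T}]\le E\big[s_{1:T}^i+(k^i+2)\sqrt{2s_{1:T}^i}+2(k^i+2)^2\big]$ for all $i$. (ii) If $\eta_t=\sqrt{\tfrac12}\min\{1,\sqrt{K/s_{<t}^{min}}\}$ (with $\sqrt{K/0}:=\infty$), $K>0$ and $k^i\le K$ for all $i$, then $E[u_{1:T}]\le E\big[s_{1:T}^i+2\sqrt{2Ks_{1:T}^i}+5K\ln(s_{1:T}^i)+3K+6\big]$ for all $i$.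
   Context: Experts are indexed by $i$ with $1\le i\le n$ (all $i\in\mathbb N$ if $n=\infty$); $k^i$ is the complexity of expert $i$. $s_t^i\in[0,1]$ is the loss of expert $i$ at time $t$, $s_{1:t}^i=\sum_{\tau\le t}s_\tau^i$, $s_{<t}^i=\sum_{\tau<t}s_\tau^i$, $s_{<t}^{min}=\min_is_{<t}^i$. Independent randomization: $q_1,\dots,q_T$ are independent random vectors, each $q_t=(q_t^i)_{1\le i\le n}$ having independent components exponentially distributed with rate 1 (density $e^{-x}$, $x\ge0$). At time $t$, FPL selects $I_t=\arg\min_i\{s_{<t}^i+(k^i-q_t^i)/\eta_t\}$ (attained almost surely) and incurs actual loss $u_t=s_t^{I_t}$. Adaptive adversary: the loss vector $s_t\in[0,1]^n$ may be an arbitrary (measurable) function of the past perturbations $q_1,\dots,q_{t-1}$ (hence of FPL's past decisions and past losses), but not of $q_t,\dots,q_T$. The quantity $\ell_t$ is the expectation of $u_t$ over $q_t$ only, with $s_1,\dots,s_t$ held fixed (i.e. $\ell_t=E[u_t\mid q_1,\dots,q_{t-1}]$); $\ell_{<t}=\sum_{\tau<t}\ell_\tau$, $\ell_{1:T}=\sum_{t\le T}\ell_t$. $E$ without further specification is the expectation over $q_1,\dots,q_T$.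
   Formalization: In (4)(ii) the term 5K ln(s_{1:T}^i) is replaced by 5K max{0, ln(s_{1:T}^i)}: as printed the bound is false for very small total losses (e.g. two experts, k^i=K=ln 2, T=1, both losses e^{-100}) and undefined for total loss 0. *)

(* Defs.v *)
From HB Require Import structures.
From mathcomp Require Import all_boot all_order all_algebra.
From mathcomp Require Import all_classical all_reals all_analysis.

Set Implicit Arguments.
Unset Strict Implicit.
Unset Printing Implicit Defensive.

Import Order.TTheory GRing.Theory Num.Theory.
Import numFieldNormedType.Exports.

Local Open Scope classical_set_scope.
Local Open Scope ring_scope.

(* [Some m] stands for n = m and [None] for n = oo, so that [expert n] is
   {1, ..., m}, respectively {1, 2, ...}. *)
Definition expert (n : option nat) : Type :=
  {i : nat | (0 < i)%N && oapp (fun m => (i <= m)%N) true n}.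

Section ProductSpace.
Variables (I : Type) (R : realType).

Definition cylinders : set (set (I -> R)) :=
  [set C | exists i (B : set R), measurable B /\ C = [set x | B (x i)]].

Definition prod_space := g_sigma_algebraType cylinders.
End ProductSpace.

(* Mutual independence of the random elements X i, i in D: the product rule
   holds for every finite subfamily. *)
Definition mutually_independent (d d' : measure_display)
    (Omega : measurableType d) (S : measurableType d') (R : realType)
    (P : probability Omega R) (I : eqType) (D : set I)
    (X : I -> Omega -> S) : Prop :=
  forall (J : seq I) (B : I -> set S), uniq J ->
    (forall i, i \in J -> D i /\ measurable (B i)) ->
    (P (\bigcap_(i in [set` J]) (X i @^-1` B i))
     = \prod_(i <- J) P (X i @^-1` B i))%E.

Section FPL.
Variables (R : realType) (n : option nat).
Variables (d : measure_display) (Omega : measurableType d).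
Variable P : probability Omega R.

Implicit Types (k c x : expert n -> R) (s : nat -> Omega -> expert n -> R).
Implicit Types (eta : nat -> Omega -> R).

(* [q t i] is the perturbation of expert i at time t, for 1 <= t <= T; other
   times are unconstrained and never used. *)
Definition perturbations (T : nat) (q : nat -> expert n -> {RV P >-> R}) :
    Prop :=
  [/\ mutually_independent P [set t | (1 <= t <= T)%N]
        (fun t w => (fun i => q t i w) : prod_space (expert n) R),
      (forall t, (1 <= t <= T)%N ->
        mutually_independent P [set: expert n] (fun i w => q t i w)) &
      (forall t i B, (1 <= t <= T)%N -> measurable B ->
        P (q t i @^-1` B) = exponential_prob 1 B)].

(* The perturbations of the times 1, ..., t - 1; the other coordinates are
   erased, so a function of [past t x] cannot see the present or the future. *)
Definition past (t : nat) (x : nat -> expert n -> R) :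
    prod_space (nat * expert n) R :=
  fun p => if (1 <= p.1 < t)%N then x p.1 p.2 else 0.

Definition adversary (T : nat)
    (A : nat -> prod_space (nat * expert n) R -> prod_space (expert n) R) :
    Prop :=
  forall t, (1 <= t <= T)%N ->
    measurable_fun [set: prod_space (nat * expert n) R] (A t) /\
    (forall h i, 0 <= A t h i <= 1).

Definition losses
    (A : nat -> prod_space (nat * expert n) R -> prod_space (expert n) R)
    (q : nat -> expert n -> {RV P >-> R}) : nat -> Omega -> expert n -> R :=
  fun t w => A t (past t (fun tau i => q tau i w)).

(* s_{<t}^i; the total s_{1:T}^i is [loss_before s T.+1 w i]. *)
Definition loss_before s (t : nat) (w : Omega) (i : expert n) : R :=
  \sum_(1 <= tau < t) s tau w i.

(* Minimum over the experts.  It is used only for families whose minimum is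
   attained as soon as sum_i exp(- k^i) <= 1: either there are finitely many
   experts or the family tends to +oo along the experts. *)
Definition min_experts c : R := inf (range c).

Definition is_argmin c (i : expert n) : Prop := forall j, c i <= c j.

(* The minimizer of c, with ties broken towards the smallest index, and [None]
   if the minimum is not attained. *)
Definition leader c : option (expert n) :=
  xget None [set Some i | i in
    [set i | is_argmin c i /\ forall j, is_argmin c j -> (val i <= val j)%N]].

(* Loss of FPL with current losses [cur], past cumulative losses [prev],
   learning rate [r] and perturbation [x]; the value 0 in the absence of a
   minimizer only matters on a null event. *)
Definition fpl_loss k (prev cur : expert n -> R) (r : R) x : R :=
  oapp cur 0 (leader (fun i => prev i + (k i - x i) / r)).

(* u_t *)
Definition actual_loss k s (q : nat -> expert n -> {RV P >-> R}) eta
    (t : nat) (w : Omega) : R :=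
  fpl_loss k (loss_before s t w) (s t w) (eta t w) (fun i => q t i w).

(* l_t: the losses and the learning rate are frozen at their value at w, and
   only the perturbation q_t is averaged, by the inner sample point w'. *)
Definition expected_loss k s (q : nat -> expert n -> {RV P >-> R}) eta
    (t : nat) (w : Omega) : R :=
  fine ('E_P[fun w' =>
    fpl_loss k (loss_before s t w) (s t w) (eta t w) (fun i => q t i w')]).

(* l_{<t} *)
Definition expected_before k s (q : nat -> expert n -> {RV P >-> R}) eta
    (t : nat) (w : Omega) : R :=
  \sum_(1 <= tau < t) expected_loss k s q eta tau w.

End FPL.

(* max(0, ln x).  A regret bound containing the term 5 K ln(s) is meant for
   s >= 1: for two experts with a common tiny total loss s > 0 the untruncated
   right-hand side is negative, whereas the loss of FPL is s. *)
Definition ln_pos (R : realType) (x : R) : R := ln (Num.max 1 x).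

(* Main.v *)
(* FPL is compared with the infeasible leader, which already knows the losses of
   the current round.  Increasing the perturbation of expert i by eta_t maps the
   event that FPL picks i into the event that the infeasible leader picks i, so
   the memoryless exponential law gives l_t <= e^(eta_t) r_t.  The infeasible
   leader, run with the same perturbation at all times, satisfies
   r_{1:T} <= s_{1:T}^i + k^i / eta_T on every sample path, because
   E sum_j (x_j - k^j)^+ <= sum_j e^(-k^j) <= 1.  Each learning rate then reduces
   to an inequality between real sequences.  Finally E u_t = E l_t, since the past
   and q_t are independent and s_t, eta_t depend on the past only. *)

Require Import Defs.
From HB Require Import structures.
From mathcomp Require Import all_boot all_order all_algebra.
From mathcomp Require Import all_classical all_reals all_analysis.
From mathcomp Require Import measurable_realfun.
From mathcomp Require Import ring lra.

Set Implicit Arguments.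
Unset Strict Implicit.
Unset Printing Implicit Defensive.

Import Order.TTheory GRing.Theory Num.Theory.
Import numFieldNormedType.Exports.

Local Open Scope classical_set_scope.
Local Open Scope ring_scope.

(** The comparison with the infeasible leader is made after freezing the sample point. Losses and
    rates are then deterministic sequences, and since l_t averages over q_t alone and all q_t have
    the same law, one perturbation may stand for all rounds although the actual ones are
    independent. Adaptivity matters again only for E u_t = E l_t, where dependence on the past means
    measurability for the sigma-algebra of the earlier perturbations. With infinitely many experts a
    leader may fail to exist, and its existence is never established: the loss 0 in that case and
    integrals of nonnegative extended functions take care of it. The factor e^(eta_t) is linearised
    in two ways. The bound 1 - eta <= e^(-eta) leaves an error eta_t l_t, suited to rates tuned to l
    or to t; the bound e^eta <= 1 + eta + eta^2 leaves an error in r_t, suited to rates tuned to s.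
    The hardest case is (4)(ii): its rate sees only the best past loss, while r_{<t} may exceed that
    by K / eta_{t-1}. Summation by parts against this excess is what produces the logarithm. *)

(** * Measures determined by their values on boxes *)

Section Boxes.
Variables (T : Type) (I : choiceType) (R : realType).
Variables (D : set I) (X : I -> T -> R).

(** The maps [X i] live on an arbitrary [T], so that the same uniqueness result serves the product
    space (projections) and the sigma-algebra of the past (perturbations of earlier times). *)
Definition coord_cylinders : set (set T) :=
  [set C | exists i (B : set R), [/\ D i, measurable B & C = X i @^-1` B]].

Definition box (s : seq I) (B : I -> set R) : set T :=
  [set w | forall i, i \in s -> B i (X i w)].

Definition boxes : set (set T) :=
  [set C | exists s B, [/\ uniq s,
    (forall i, i \in s -> D i /\ measurable (B i)) & C = box s B]].

Lemma box_bigcap s B : box s B = \bigcap_(i in [set` s]) (X i @^-1` B i).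
Proof. by []. Qed.

Lemma boxes_setI : setI_closed boxes.
Proof.
move=> _ _ [s [B [us sB ->]]] [s' [B' [us' sB' ->]]].
pose C i := (if i \in s then B i else setT) `&` (if i \in s' then B' i else setT).
exists (undup (s ++ s')), C; split; first exact: undup_uniq.
- move=> i; rewrite mem_undup mem_cat => /orP ii; split.
    by case: ii => [/sB[]|/sB'[]].
  by apply: measurableI; case: ifPn => // {}ii; first [by case: (sB i ii)|by case: (sB' i ii)].
- apply/seteqP; split=> [w [wB wB'] i _|w wC].
    by split; case: ifPn => // ii; first [exact: wB|exact: wB'].
  split=> i ii; have := wC i; rewrite mem_undup mem_cat ii ?orbT => /(_ isT);
    by rewrite /C ii => -[].
Qed.

Lemma coord_cylinders_box : coord_cylinders `<=` boxes.
Proof.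
move=> _ [i [B [Di mB ->]]]; exists [:: i], (fun=> B); split=> //.
  by move=> j; rewrite inE => /eqP->.
apply/seteqP; split=> [w wB j|w wB]; first by rewrite inE => /eqP->.
by apply: (wB i); rewrite inE.
Qed.

End Boxes.

Section BoxUniqueness.
Variables (d : measure_display) (T : measurableType d) (I : choiceType).
Variables (R : realType) (D : set I) (X : I -> T -> R).

Lemma measurable_box s (B : I -> set R) :
  (forall i, i \in s -> measurable (X i @^-1` B i)) -> measurable (box X s B).
Proof.
move=> mB; rewrite box_bigcap; apply: fin_bigcap_measurable; first exact: finite_seq.
by move=> i /= /mB.
Qed.

Hypothesis genT : @measurable d T = <<s coord_cylinders D X >>.

Lemma measurable_coord i : D i -> measurable_fun [set: T] (X i).
Proof.
by move=> Di _ B mB; rewrite setTI genT; apply: sub_sigma_algebra; exists i, B.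
Qed.

(** Boxes are stable under intersection, generate the sigma-algebra and include the whole space as
    the box without constraints, so the pi-lambda argument applies to finite measures. *)
Lemma box_measure_unique (m1 m2 : {measure set T -> \bar R}) :
  (m1 [set: T] < +oo)%E ->
  (forall s B, uniq s -> (forall i, i \in s -> D i /\ measurable (B i)) ->
    m1 (box X s B) = m2 (box X s B)) ->
  forall E, measurable E -> m1 E = m2 E.
Proof.
move=> m1oo m12 E mE.
apply: (measure_unique (boxes D X) (fun=> setT)) => //.
- rewrite genT; apply/seteqP; split.
    by apply: sub_sigma_algebra2; exact: coord_cylinders_box.
  apply: smallest_sub; first exact: smallest_sigma_algebra.
  move=> _ [s [B [us sB ->]]]; rewrite -genT; apply: measurable_box => i /sB[Di mB].
  by rewrite -[_ @^-1` _]setTI; exact: measurable_coord.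
- exact: boxes_setI.
- move=> _; exists [::], (fun=> setT); split=> //.
  by apply/seteqP; split=> // w _ i.
- by apply/seteqP; split=> // w _; exists 0%N.
- by move=> _ [s [B [us sB ->]]]; exact: m12.
Qed.

End BoxUniqueness.

Section ProdSpace.
Variables (I : choiceType) (R : realType).

Lemma prod_space_cylinders :
  @measurable _ (prod_space I R) =
  <<s coord_cylinders [set: I] (fun i (x : prod_space I R) => x i) >>.
Proof.
rewrite [LHS](_ : _ = <<s @cylinders I R >>)//; congr (<<s _ >>).
apply/seteqP; split=> [_ [i [B [mB ->]]]|_ [i [B [_ mB ->]]]].
  by exists i, B.
by exists i, B.
Qed.

Lemma measurable_proj i : measurable_fun [set: prod_space I R] (fun x => x i).
Proof. exact: (measurable_coord prod_space_cylinders). Qed.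

Lemma measurable_to_prod_space d (T : measurableType d)
    (f : T -> prod_space I R) :
  (forall i, measurable_fun [set: T] (fun w => f w i)) ->
  measurable_fun [set: T] f.
Proof.
move=> mf; apply: (measurability _ prod_space_cylinders).
move=> _ [_ [i [B [_ mB ->]]] <-].
by rewrite setTI -[X in measurable X]setTI; exact: mf.
Qed.

End ProdSpace.

(** * The exponential law: memorylessness and mean excess *)

Section ExponentialTail.
Variable R : realType.

(** [Num.max 0 b] merges the absence of mass on the negative axis with the exponential decay. The
    two lemmas that follow use the law only through this tail. *)
Lemma exponential_tail (mu : probability R R) :
  (forall B, measurable B -> mu B = exponential_prob 1 B) ->
  forall b, mu `]b, +oo[%classic = (expR (- Num.max 0 b))%:E.
Proof.
move=> muE b.
have mu0 : mu `]-oo, 0[%classic = 0%E.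
  rewrite muE// /exponential_prob integral0_eq// => x.
  by rewrite /= in_itv/= => x0; rewrite lt0_exponential_pdf.
have muc x : 0 <= x -> mu `[0, x]%classic = (1 - expR (- x))%:E.
  rewrite le_eqVlt => /predU1P[<-|x0].
    rewrite set_itv1 muE// oppr0 expR0 subrr.
    by rewrite /exponential_prob integral_set1.
  by rewrite muE// exponential_prob_itv0c// mulN1r EFinB.
have -> : mu `]b, +oo[%classic = (1 - mu `]-oo, b]%classic)%E.
  by rewrite -probability_setC// setCitvl.
have [b0|b0] := lerP b 0.
  suff -> : mu `]-oo, b]%classic = 0%E by rewrite sube0 oppr0 expR0.
  apply/eqP; rewrite eq_le measure_ge0 andbT.
  have -> : 0%E = (mu `]-oo, 0%R[%classic + mu `[0%R, 0%R]%classic)%E.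
    by rewrite mu0 muc// oppr0 expR0 subrr add0e.
  rewrite -measureU//; last first.
    apply/seteqP; split=> // x []/=; rewrite !in_itv/= => x0 /andP[].
    by rewrite leNgt x0.
  apply: le_measure; rewrite ?inE//; first exact: measurableU.
  move=> x /=; rewrite in_itv/= => xb; rewrite /= !in_itv/=.
  by have [x0|x0] := ltP x 0; [left|right; rewrite (le_trans xb b0)].
have -> : mu `]-oo, b]%classic = (mu `]-oo, 0%R[%classic + mu `[0%R, b]%classic)%E.
  rewrite -measureU//; last first.
    apply/seteqP; split=> // x []/=; rewrite !in_itv/= => x0 /andP[].
    by rewrite leNgt x0.
  congr (mu _); apply/seteqP; split=> x /=; rewrite !in_itv/=.
    by move=> xb; rewrite xb andbT; case: ltP; [left|right].
  by case=> [/ltW x0|/andP[]//]; exact: le_trans (ltW b0).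
rewrite mu0 add0e muc ?ltW//; congr EFin; ring.
Qed.

Variable mu : probability R R.
Hypothesis mu_tail : forall b, mu `]b, +oo[%classic = (expR (- Num.max 0 b))%:E.

(** Memorylessness as an identity of measures in [B]: both sides are finite, and it suffices to
    compare them on the rays ]b, +oo[, which are stable under intersection and generate the Borel
    sets. *)
Lemma exponential_shift (a : R) (B : set R) : 0 <= a -> measurable B ->
  mu [set y | B (y + a)] = ((expR a)%:E * mu (B `&` `]a, +oo[%classic))%E.
Proof.
move=> a0 mB.
have madd : measurable_fun [set: R] (fun y : R => y + a).
  by apply: measurable_funD.
pose shift : {RV mu >-> R} := mfun_Sub (mem_set madd).
pose m1 : {measure set R -> \bar R} := distribution mu shift.
have mD : measurable (`]a, +oo[%classic : set R) by [].
pose m2 : {measure set R -> \bar R} :=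
  mscale (NngNum (expR_ge0 a)) (mrestr mu mD).
rewrite -[LHS]/(m1 B) -[RHS]/(m2 B).
apply: (measure_unique (@RGenOInfty.G R) (fun k => `](- k%:R), +oo[%classic)) => //.
- exact: RGenOInfty.measurableE.
- move=> _ _ [x ->] [y ->]; exists (Num.max x y).
  by apply/seteqP; split=> z /=; rewrite !in_itv/= !andbT gt_max;
    [case=> -> ->|move/andP].
- by move=> k; exists (- k%:R).
- apply/seteqP; split=> // x _; exists (Num.truncn `|x|).+1 => //=.
  rewrite in_itv/= andbT ltrNl.
  by rewrite (le_lt_trans _ (truncnS_gt _))// -normrN ler_norm.
- move=> _ [b ->].
  have -> : m1 `]b, +oo[%classic = mu `](b - a), +oo[%classic.
    rewrite /m1 /= /distribution /pushforward; congr (mu _).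
    by apply/seteqP; split=> z /=; rewrite !in_itv/= !andbT ltrBlDr.
  have -> : m2 `]b, +oo[%classic = ((expR a)%:E * mu `](Num.max a b), +oo[%classic)%E.
    rewrite /m2 /= /mscale /mrestr /=; congr (_ * mu _)%E.
    by apply/seteqP; split=> z /=; rewrite !in_itv/= !andbT gt_max;
      [case=> -> ->|move/andP=> -[-> ->]].
  (* The exponents agree because max(0, b - a) = max(a, b) - a. *)
  rewrite !mu_tail -EFinM -expRD; congr (expR _)%:E.
  have -> : Num.max 0 (Num.max a b) = Num.max a b by rewrite maxA (max_r a0).
  have [ab|ba] := leP a b; last by rewrite max_l ?oppr0 ?subrr// subr_le0 ltW.
  by rewrite max_r ?subr_ge0// opprB.
- by move=> k; rewrite (le_lt_trans (probability_le1 _ _)) ?ltry.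
Qed.

(** The mean of a nonnegative variable is the integral of its tail, here e^(-a-r) over r >= 0. The
    case a = 0 is the mean 1 of the law. *)
Lemma exponential_excess (a : R) : 0 <= a ->
  (\int[mu]_y (Num.max 0 (y - a))%:E = (expR (- a))%:E)%E.
Proof.
move=> a0.
have mX : measurable_fun [set: R] (fun y : R => Num.max 0 (y - a)).
  by apply: measurable_maxr => //; exact: measurable_funB.
pose X : {RV mu >-> R} := mfun_Sub (mem_set mX).
have X0 y : 0 <= X y by rewrite /X/= le_max lexx.
have := ge0_expectation_ccdf X0; rewrite unlock => ->.
have e1 : (\int[lebesgue_measure]_(r in `[0%R, +oo[) (expR (- r))%:E = (1 : \bar R))%E.
  rewrite -(integral_exponential_pdf (@ltr01 R)) [LHS]integral_mkcond.
  apply: eq_integral => r _; rewrite /exponential_pdf !patchE.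
  by case: ifP => // _; rewrite mul1r mulN1r.
transitivity (\int[lebesgue_measure]_(r in `[0%R, +oo[)
    ((expR (- a))%:E * (expR (- r))%:E))%E.
  apply: eq_integral => r; rewrite inE/= in_itv/= andbT => r0.
  rewrite /ccdf /distribution /= /pushforward.
  have -> : X @^-1` `]r, +oo[%classic = `](a + r), +oo[%classic.
    apply/seteqP; split=> y /=; rewrite !in_itv/= !andbT lt_max ltrBrDl.
      by case/orP => //; rewrite ltNge r0.
    by move=> ->; rewrite orbT.
  by rewrite mu_tail max_r ?addr_ge0// opprD expRD EFinM.
rewrite ge0_integralZl ?lee_fin ?expR_ge0// ?e1 ?mule1//.
by apply/measurable_EFinP/measurableT_comp => //; exact: measurable_funTS.
Qed.

End ExponentialTail.

(** * Countable families of independent exponential variables *)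

Section CountableSums.
Variables (R : realType) (I : countType).

(** Turns an unordered sum over experts into a series over their codes, with 0 at numbers that code
    nothing; monotone convergence is then applied to the series. *)
Lemma esum_pickle (f : I -> \bar R) : (forall i, 0 <= f i)%E ->
  (\esum_(i in [set: I]) f i = \sum_(m <oo) oapp f 0 (pickle_inv m))%E.
Proof.
move=> f0; pose a m := oapp f 0%E (@pickle_inv I m).
have a0 m : (0 <= a m)%E by rewrite /a; case: pickle_inv => /=.
rewrite nneseries_esumT// -[LHS]/(\esum_(i in [set: I]) f i)%E.
have -> : (\esum_(m in [set: nat]) a m = \esum_(m in range (@pickle I)) a m)%E.
  rewrite [RHS]esum_mkcond; apply: eq_esum => m _.
  case: ifPn => // /negP ma; rewrite /a.
  case E : pickle_inv => [i|//]; case: ma; rewrite inE; exists i => //.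
  by have := @pickle_invK I m; rewrite /ocancel E.
rewrite (@reindex_esum _ _ _ [set: I] _ pickle); last first.
  split=> //; by move=> i j _ _ /(congr1 unpickle); rewrite !pickleK => -[].
by apply: eq_esum => i _; rewrite /a pickleK_inv.
Qed.

End CountableSums.

Section IidExponential.
Variables (R : realType) (I : countType).
Variable nu : probability (prod_space I R) R.

(** Marginals and independence in one condition, which determines [nu] because boxes do. *)
Definition iid_exponential := forall s B, uniq s ->
  (forall i, i \in s -> measurable (B i)) ->
  (nu (box (fun i (x : prod_space I R) => x i) s B) =
   \prod_(i <- s) exponential_prob 1 (B i))%E.

Hypothesis nu_iid : iid_exponential.

Definition coord_rv (i : I) : {RV nu >-> R} :=
  mfun_Sub (mem_set (measurable_proj (R := R) i)).

Lemma iid_coord i B : measurable B ->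
  distribution nu (coord_rv i) B = exponential_prob 1 B.
Proof.
move=> mB; have := @nu_iid [:: i] (fun=> B) isT (fun _ _ => mB).
rewrite big_seq1 => <-; rewrite /distribution /= /pushforward; congr (nu _).
apply/seteqP; split=> [x xB j|x xB]; first by rewrite inE => /eqP->.
by apply: (xB i); rewrite inE.
Qed.

Lemma integral_excess i (a : R) : 0 <= a ->
  (\int[nu]_x (Num.max 0 (x i - a))%:E = (expR (- a))%:E)%E.
Proof.
move=> a0; rewrite -(exponential_excess (exponential_tail (@iid_coord i)) a0).
rewrite (ge0_integral_distribution (coord_rv i)
  (f := fun y : R => (Num.max 0 (y - a))%:E))//.
  apply/measurable_EFinP; apply: measurable_maxr => //.
  exact: measurable_funB.
by move=> y; rewrite lee_fin le_max lexx.
Qed.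

(** A measurable upper bound of the supremum of x_i - k_i whose mean can be computed term by term;
    with infinitely many indices it may be infinite, hence the extended reals. *)
Definition excess (k : I -> R) (x : prod_space I R) : \bar R :=
  \esum_(i in [set: I]) (Num.max 0 (x i - k i))%:E.

Lemma excess_ge0 k x : (0 <= excess k x)%E.
Proof. by apply: esum_ge0 => i _; rewrite lee_fin le_max lexx. Qed.

Lemma excess_ge k x i : ((x i - k i)%:E <= excess k x)%E.
Proof.
apply: esum_ge; exists [set i]; first by split=> //; exact: finite_set1.
by rewrite fsbig_set1 lee_fin le_max lexx orbT.
Qed.

Lemma excess_pickle k x : excess k x =
  (\sum_(m <oo) oapp (fun i => (Num.max 0 (x i - k i))%:E) 0 (pickle_inv m))%E.
Proof. by apply: esum_pickle => i; rewrite lee_fin le_max lexx. Qed.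

Lemma measurable_excess k : measurable_fun [set: prod_space I R] (excess k).
Proof.
rewrite (funext (excess_pickle k)).
apply: ge0_emeasurable_sum => m.
  by move=> x _ _; case: pickle_inv => //= i; rewrite lee_fin le_max lexx.
move=> _; case: pickle_inv => //= i; apply/measurable_EFinP.
by apply: measurable_maxr => //; apply: measurable_funB => //; exact: measurable_proj.
Qed.

Lemma integral_excess_esum k : (forall i, 0 <= k i) ->
  (\int[nu]_x excess k x = \esum_(i in [set: I]) (expR (- k i))%:E)%E.
Proof.
move=> k0; rewrite esum_pickle; last by move=> i; rewrite lee_fin expR_ge0.
under eq_integral do rewrite excess_pickle.
rewrite integral_nneseries//.
- apply: eq_eseriesr => m _; case: pickle_inv => [i|] /=; last by rewrite integral0.
  exact: integral_excess.
- move=> m; case: pickle_inv => //= i; apply/measurable_EFinP.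
  by apply: measurable_maxr => //; apply: measurable_funB => //; exact: measurable_proj.
- by move=> m x _; case: pickle_inv => //= i; rewrite lee_fin le_max lexx.
Qed.

Definition shift_coord (i : I) (a : R) (x : prod_space I R) : prod_space I R :=
  fun j => if j == i then x j + a else x j.

Lemma measurable_shift_coord i a :
  measurable_fun [set: prod_space I R] (shift_coord i a).
Proof.
apply: measurable_to_prod_space => j; rewrite /shift_coord.
case: (j == i); last exact: measurable_proj.
by apply: measurable_funD => //; exact: measurable_proj.
Qed.

Let iid_box_setI i (s : seq I) B (C : set R) : i \notin s -> uniq s ->
  (forall j, j \in s -> measurable (B j)) -> measurable C ->
  (nu (box (fun i (x : prod_space I R) => x i) s B `&` [set x | C (x i)]) =
   distribution nu (coord_rv i) C * nu (box (fun i (x : prod_space I R) => x i) s B))%E.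
Proof.
move=> ins us mB mC.
pose B' j := if j == i then C else B j.
have -> : box (fun i (x : prod_space I R) => x i) s B `&` [set x | C (x i)] =
    box (fun i (x : prod_space I R) => x i) (i :: s) B'.
  apply/seteqP; split=> x.
    move=> [xB xC] j; rewrite inE /B'; case: eqP => [->//|_] /= js; exact: xB.
  move=> xB; split.
    move=> j js; have := xB j; rewrite inE js orbT => /(_ isT).
    by rewrite /B'; case: eqP => // ji; rewrite -ji js in ins.
  by have := xB i; rewrite mem_head /B' eqxx => /(_ isT).
rewrite nu_iid/= ?ins//.
  rewrite big_cons {1}/B' eqxx iid_coord// nu_iid//; congr (_ * _)%E.
  apply: eq_big_seq => j js; rewrite /B'; case: eqP => // ji.
  by rewrite -ji js in ins.
by move=> j; rewrite inE /B'; case: eqP => //= _; exact: mB.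
Qed.

(** Memorylessness of one coordinate lifted to the product: both sides are measures in [E], and on a
    box the factor of coordinate i splits off, which reduces the claim to [exponential_shift]. *)
Lemma nu_shift_coord i a E : 0 <= a -> measurable E ->
  (nu (shift_coord i a @^-1` E) =
   (expR a)%:E * nu (E `&` [set x | (a < x i)%R]))%E.
Proof.
move=> a0 mE.
pose sh : {RV nu >-> prod_space I R} :=
  mfun_Sub (mem_set (measurable_shift_coord i a)).
have mD : measurable [set x : prod_space I R | a < x i].
  have -> : [set x : prod_space I R | a < x i] = (fun x => x i) @^-1` `]a, +oo[%classic.
    by apply/seteqP; split=> x /=; rewrite in_itv/= andbT.
  by rewrite -[X in measurable X]setTI; exact: measurable_proj.
pose m1 : {measure set (prod_space I R) -> \bar R} := distribution nu sh.
pose m2 : {measure set (prod_space I R) -> \bar R} :=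
  mscale (NngNum (expR_ge0 a)) (mrestr nu mD).
rewrite -[LHS]/(m1 E) -[RHS]/(m2 E).
apply: (box_measure_unique (@prod_space_cylinders I R)) => //.
  by rewrite (le_lt_trans (probability_le1 _ _)) ?ltry.
move=> s B us sB.
(* The constraint on coordinate i is separated from the others; it is [setT] when the box leaves
   that coordinate free. *)
pose s0 := [seq j <- s | j != i].
pose C := if i \in s then B i else setT.
have ins0 : i \notin s0 by rewrite mem_filter eqxx.
have us0 : uniq s0 by exact: filter_uniq.
have mC : measurable C by rewrite /C; case: ifPn => // /sB[].
have mB j : j \in s0 -> measurable (B j).
  by rewrite mem_filter => /andP[_] /sB[].
pose bx := box (fun i (x : prod_space I R) => x i).
have sE : bx s B = bx s0 B `&` [set x | C (x i)].
  apply/seteqP; split=> x.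
    move=> xB; split; first by move=> j; rewrite mem_filter => /andP[_ /xB].
    by rewrite /C/=; case: ifPn => // /xB.
  move=> [xB xC] j js; have [ji|ji] := eqVneq j i.
    by move: xC; rewrite /C -ji js.
  by apply: xB; rewrite mem_filter ji.
rewrite -/(bx s B) sE.
have -> : m1 (bx s0 B `&` [set x | C (x i)]) =
    nu (bx s0 B `&` [set x | [set y | C (y + a)] (x i)]).
  rewrite /m1 /= /distribution /= /pushforward; congr (nu _).
  apply/seteqP; split=> x [xB]; rewrite /= /shift_coord eqxx => xC; split=> // j js.
    have := xB j js; rewrite /shift_coord; case: eqP => // ji.
    by rewrite -ji js in ins0.
  case: eqP => [ji|_]; first by rewrite -ji js in ins0.
  exact: xB.
rewrite iid_box_setI//; last first.
  have madd : measurable_fun [set: R] (fun y : R => y + a) by exact: measurable_funD.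
  by rewrite -[X in measurable X]setTI; exact: madd.
rewrite (exponential_shift (exponential_tail (@iid_coord i)))//.
have -> : m2 (bx s0 B `&` [set x | C (x i)]) =
    ((expR a)%:E * nu (bx s0 B `&` [set x | (C `&` `]a, +oo[%classic) (x i)]))%E.
  rewrite /m2 /= /mscale /mrestr /=; congr (_ * nu _)%E.
  apply/seteqP; split=> x /=; rewrite in_itv/= andbT; first by case=> -[].
  by case=> xB [].
by rewrite iid_box_setI ?muleA//; exact: measurableI.
Qed.

End IidExponential.

(** * The leader: stability, measurability and expected loss *)

HB.instance Definition _ (n : option nat) := Countable.copy (expert n)
  {i : nat | (0 < i)%N && oapp (fun m => (i <= m)%N) true n}.

Section Leader.
Variables (R : realType) (n : option nat).
Implicit Types (c k prev cur : expert n -> R) (i j : expert n).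

Lemma leaderP c i : leader c = Some i <->
  is_argmin c i /\ forall j, is_argmin c j -> (val i <= val j)%N.
Proof.
rewrite /leader; set S := [set Some i | i in _]; split.
  by case: xgetP => // _ -> [j Sj <-] [<-].
move=> Si; apply: xget_unique; first by exists i.
move=> _ [j Sj <-]; congr Some; apply: val_inj; apply/eqP; rewrite eqn_leq.
by case: Si Sj => ci mi [cj mj]; apply/andP; split; [exact: mj|exact: mi].
Qed.

(** The tie rule becomes a strict inequality against smaller indices, so that leading is a countable
    conjunction of comparisons between two scores. This form is measurable and survives a shift of
    the scores. *)
Lemma leaderE c i : leader c = Some i <->
  (forall j, c i <= c j) /\ forall j, (val j < val i)%N -> c i < c j.
Proof.
rewrite leaderP; split=> [[ci mi]|[ci mi]]; split=> // j.
  move=> ji; rewrite ltNge; apply/negP => cji.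
  suff /mi : is_argmin c j by rewrite leqNgt ji.
  by move=> l; exact: le_trans cji (ci l).
by move=> cj; rewrite leqNgt; apply/negP => /mi; rewrite ltNge cj.
Qed.

Variable k : expert n -> R.

Let score prev (r : R) (x : expert n -> R) i := prev i + (k i - x i) / r.

(** Raising x_i by r lowers the score of i by exactly 1, which pays for [cur i], while no other
    score drops. Weak and strict inequalities both persist, so the tie-breaking does too. *)
Lemma leader_shift_coord prev cur (r : R) x i : 0 < r ->
  (forall j, 0 <= cur j <= 1) ->
  leader (score prev r x) = Some i ->
  leader (score (fun j => prev j + cur j) r (shift_coord i r x)) = Some i.
Proof.
move=> r0 cur01 /leaderE [mi si]; apply/leaderE.
have iE : score (fun j => prev j + cur j) r (shift_coord i r x) i <= score prev r x i.
  rewrite /score /shift_coord eqxx opprD addrA [(_ - r) / r]mulrBl divff ?gt_eqF//.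
  by have /andP[_] := cur01 i; lra.
have jE j : j != i -> score prev r x j <=
    score (fun j => prev j + cur j) r (shift_coord i r x) j.
  move=> /negPf ji; rewrite /score /shift_coord ji.
  by have /andP[+ _] := cur01 j; lra.
split=> j; have [-> //|ji] := eqVneq j i.
- by apply: (le_trans iE); apply: le_trans (mi j) (jE _ ji).
- by rewrite ltnn.
- move=> /si sij.
  by apply: (le_lt_trans iE); apply: lt_le_trans sij (jE _ ji).
Qed.

End Leader.

Section LeaderMeasurable.
Variables (R : realType) (n : option nat).
Variables (d : measure_display) (T : measurableType d).

Lemma measurable_forall (I : countType) (F : I -> set T) :
  (forall i, measurable (F i)) -> measurable [set w | forall i, F i w].
Proof.
move=> mF; rewrite (_ : [set w | _] = ~` \bigcup_i ~` F i).
  apply: measurableC; apply: countable_bigcupT_measurable => // i.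
  exact: measurableC.
rewrite setC_bigcup; apply/seteqP; split=> w /= wF; first by move=> i _ /(_ (wF i)).
by move=> i; apply: contrapT; exact: (wF i).
Qed.

Lemma measurable_leader (c : T -> expert n -> R) i :
  (forall j, measurable_fun [set: T] (fun w => c w j)) ->
  measurable [set w | leader (c w) = Some i].
Proof.
move=> mc.
rewrite (_ : [set w | _] = [set w | forall j, [set w | c w i <= c w j] w] `&`
    [set w | forall j, [set w | (val j < val i)%N -> c w i < c w j] w]); last first.
  by apply/seteqP; split=> w /leaderE.
apply: measurableI; apply: measurable_forall => j.
  rewrite -[X in measurable X]setTI.
  exact: (measurable_fun_ler (mc i) (mc j)).
have [ji|ij] := boolP (val j < val i)%N.
  rewrite -[X in measurable X]setTI.
  rewrite (_ : [set: T] `&` _ = [set: T] `&` [set w | c w i < c w j]).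
    exact: (measurable_fun_ltr (mc i) (mc j)).
  by congr (_ `&` _); apply/seteqP; split=> w /=; [exact|].
rewrite [X in measurable X](_ : _ = setT)//.
by apply/seteqP; split=> // w _ /= ji; rewrite ji in ij.
Qed.

Lemma measurable_leader_value (c cur : T -> expert n -> R) :
  (forall j, measurable_fun [set: T] (fun w => c w j)) ->
  (forall j, measurable_fun [set: T] (fun w => cur w j)) ->
  measurable_fun [set: T] (fun w => oapp (cur w) 0 (leader (c w))).
Proof.
move=> mc mcur _ B mB; rewrite setTI.
rewrite (_ : _ @^-1` B = (\bigcup_i ([set w | leader (c w) = Some i] `&`
     (fun w => cur w i) @^-1` B)) `|`
   ([set w | forall i, (~` [set w | leader (c w) = Some i]) w] `&` (fun=> 0) @^-1` B)).
  apply: measurableU; first apply: countable_bigcupT_measurable => // i.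
    apply: measurableI; first exact: measurable_leader.
    by rewrite -[X in measurable X]setTI; exact: mcur.
  apply: measurableI.
    by apply: measurable_forall => i; apply: measurableC; exact: measurable_leader.
  by rewrite -[X in measurable X]setTI; exact: measurable_cst.
apply/seteqP; split=> w /=.
  case E : (leader (c w)) => [i|] /= wB; first by left; exists i => //; split.
  by right; split.
case=> [[i _ [/= -> //]]|[]].
by case: (leader (c w)) => // i /(_ i).
Qed.

End LeaderMeasurable.

Section LeaderIntegral.
Variables (R : realType) (n : option nat).
Variables (d : measure_display) (T : measurableType d) (nu : probability T R).
Variables (cur : expert n -> R) (cur_ge0 : forall i, 0 <= cur i).

(** The space is split along the values of the leader in [option (expert n)]; the event without a
    leader is one of the pieces, with weight 0. *)
Lemma integral_leader (c : T -> expert n -> R) :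
  (forall j, measurable_fun [set: T] (fun w => c w j)) ->
  (\int[nu]_w (oapp cur 0 (leader (c w)))%:E =
   \sum_(m <oo) (oapp (fun o => oapp cur 0 o) 0 (pickle_inv m))%:E *
     nu [set w | pickle_inv m = Some (leader (c w))])%E.
Proof.
move=> mc; pose F m := [set w | @pickle_inv (option (expert n)) m = Some (leader (c w))].
have mF m : measurable (F m).
  rewrite /F; case: pickle_inv => [[i|]|].
  - rewrite (_ : [set w | _] = [set w | leader (c w) = Some i]).
      exact: measurable_leader.
    by apply/seteqP; split=> w /= [] ->.
  - rewrite (_ : [set w | _] = [set w | forall i, (~` [set w | leader (c w) = Some i]) w]).
      by apply: measurable_forall => i; apply: measurableC; exact: measurable_leader.
    apply/seteqP; split=> w /=; first by move=> [<-].
    by case: (leader (c w)) => // i /(_ i).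
  - by rewrite (_ : [set w | _] = set0)//; apply/seteqP; split.
have cover : \bigcup_m F m = [set: T].
  by apply/seteqP; split=> // w _; exists (pickle (leader (c w))) => //=; exact: pickleK_inv.
rewrite -[in LHS]cover ge0_integral_bigcup//.
- apply: eq_eseriesr => m _.
  transitivity (\int[nu]_(w in F m)
      cst (oapp (fun o => oapp cur 0 o) 0 (@pickle_inv (option (expert n)) m))%:E w)%E.
    by apply: eq_integral => w; rewrite inE /F /= => ->.
  by rewrite integral_cst.
- rewrite cover; apply/measurable_EFinP; apply: measurable_leader_value => //.
- by move=> w _; rewrite lee_fin; case: leader => /=.
- move=> i j _ _ [w [Fi Fj]].
  have := @pickle_invK (option (expert n)) i; have := @pickle_invK (option (expert n)) j.
  by rewrite /ocancel Fi Fj /= => -> ->.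
Qed.

(** Both integrals are series with the same nonnegative weights, and the weight of [None] is 0, so a
    comparison of the events expert by expert is enough. *)
Lemma integral_leader_le (c c' : T -> expert n -> R) (K : R) : 0 <= K ->
  (forall j, measurable_fun [set: T] (fun w => c w j)) ->
  (forall j, measurable_fun [set: T] (fun w => c' w j)) ->
  (forall i, nu [set w | leader (c w) = Some i] <=
    K%:E * nu [set w | leader (c' w) = Some i])%E ->
  (\int[nu]_w (oapp cur 0 (leader (c w)))%:E <=
   K%:E * \int[nu]_w (oapp cur 0 (leader (c' w)))%:E)%E.
Proof.
move=> K0 mc mc' cc'; rewrite !integral_leader// -nneseriesZl; last first.
  move=> m _; apply: mule_ge0 => //; rewrite lee_fin.
  by case: pickle_inv => [[i|]|] /=.
apply: lee_nneseries => m _.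
  move=> _; apply: mule_ge0 => //; rewrite lee_fin.
  by case: pickle_inv => [[i|]|] /=.
case: pickle_inv => [[i|]|] /=; rewrite ?mul0e ?mule0//.
rewrite muleCA; apply: lee_wpmul2l; first by rewrite lee_fin.
suff E (b : T -> expert n -> R) : [set w | Some (Some i) = Some (leader (b w))] =
    [set w | leader (b w) = Some i] by rewrite !E.
by apply/seteqP; split=> w /= [] ->.
Qed.

End LeaderIntegral.

(** * One round: FPL against the infeasible leader *)

Section FollowThePerturbedLeader.
Variables (R : realType) (n : option nat).
Variable nu : probability (prod_space (expert n) R) R.
Hypothesis nu_iid : iid_exponential nu.
Variable k : expert n -> R.
Implicit Types (prev cur : expert n -> R) (r : R) (x : prod_space (expert n) R).

Let score prev r x i := prev i + (k i - x i) / r.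

Let measurable_score prev r i :
  measurable_fun [set: prod_space (expert n) R] (fun x => score prev r x i).
Proof.
apply: measurable_funD => //; apply: measurable_funM => //.
by apply: measurable_funB => //; exact: measurable_proj.
Qed.

Lemma measurable_fpl_loss prev cur r :
  measurable_fun [set: prod_space (expert n) R] (fpl_loss k prev cur r).
Proof. by apply: measurable_leader_value => // j; exact: measurable_score. Qed.

Lemma fpl_loss_ge0 prev cur r x : (forall i, 0 <= cur i <= 1) ->
  0 <= fpl_loss k prev cur r x <= 1.
Proof.
by move=> c01; rewrite /fpl_loss; case: leader => [i|] /=; rewrite ?c01 ?lexx ?ler01.
Qed.

(* Adding the current losses raises the score of expert i by at most 1, which is
   offset by increasing x_i by r; the exponential law shifts at the price e^r. *)
Lemma fpl_le_infeasible prev cur r : 0 < r -> (forall i, 0 <= cur i <= 1) ->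
  (\int[nu]_x (fpl_loss k prev cur r x)%:E <=
   (expR r)%:E *
     \int[nu]_x (fpl_loss k (fun i => prev i + cur i) cur r x)%:E)%E.
Proof.
move=> r0 c01; apply: integral_leader_le; rewrite ?expR_ge0//.
- by move=> i; case/andP: (c01 i).
- exact: measurable_score.
- exact: measurable_score.
- move=> i.
  have mE (p : expert n -> R) : measurable [set x | leader (score p r x) = Some i].
    by apply: measurable_leader => j; exact: measurable_score.
  (* The event that FPL picks i lies in the preimage, under the shift, of the event that the
     infeasible leader picks i. The shift formula then yields the factor e^r and a restriction to
     x_i > r, which is dropped. *)
  apply: (@le_trans _ _ (nu (shift_coord i r @^-1`
      [set x | leader (score (fun i => prev i + cur i) r x) = Some i]))).
    apply: le_measure; rewrite ?inE//; first exact: mE.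
      rewrite -[X in measurable X]setTI.
      exact: (measurable_shift_coord i r measurableT (mE (fun i => prev i + cur i))).
    by move=> x /= xi; exact: leader_shift_coord.
  rewrite (nu_shift_coord nu_iid i (ltW r0) (mE (fun i => prev i + cur i))).
  apply: lee_wpmul2l; first by rewrite lee_fin expR_ge0.
  apply: le_measure; rewrite ?inE; [|exact: mE|exact: subIsetl].
  apply: measurableI; first exact: mE.
  rewrite -[X in measurable X]setTI.
  by apply: measurable_fun_ltr => //; exact: measurable_proj.
Qed.

End FollowThePerturbedLeader.

(** * Regret of the infeasible leader *)

Section BeTheLeader.
Variables (R : realType) (n : option nat) (k : expert n -> R).
Variables (s : nat -> expert n -> R) (eta : nat -> R) (T : nat).

Definition cumulative t i : R := \sum_(1 <= tau < t) s tau i.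

Definition infeasible_loss t (x : expert n -> R) : R :=
  fpl_loss k (fun i => cumulative t i + s t i) (s t) (eta t) x.

Hypothesis s01 : forall t i, (1 <= t <= T)%N -> 0 <= s t i <= 1.
Hypothesis eta_gt0 : forall t, (1 <= t <= T)%N -> 0 < eta t.
Hypothesis eta_decr : forall t, (1 <= t)%N -> (t < T)%N -> eta t.+1 <= eta t.

Lemma cumulativeS t i : (1 <= t)%N ->
  cumulative t.+1 i = cumulative t i + s t i.
Proof. by move=> t1; rewrite /cumulative big_nat_recr. Qed.

(* The same perturbation x is used at all times.  Where no leader exists the
   loss is 0 by convention, which only helps the upper bound. *)
Lemma be_the_leader x M m : 0 <= M -> (forall j, x j - k j <= M) ->
  (1 <= m <= T)%N -> forall i,
  \sum_(1 <= t < m.+1) infeasible_loss t x <=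
    cumulative m.+1 i + (k i - x i + M) / eta m.
Proof.
move=> M0 xM; have xM0 i : 0 <= k i - x i + M by have := xM i; lra.
(* [y] is the inverse of the previous rate, or 0 before the first round. Adding [M] makes k_i - x_i
   + M nonnegative, so the bound may be relaxed from [y] to the larger inverse rate. *)
have step t S y : (1 <= t <= T)%N -> y <= (eta t)^-1 ->
    (forall i, S <= cumulative t i + (k i - x i + M) * y) ->
    forall i, S + infeasible_loss t x <=
      cumulative t.+1 i + (k i - x i + M) / eta t.
  move=> t1T yt HS i; have /andP[t1 _] := t1T; rewrite cumulativeS//.
  have HS' j : S <= cumulative t j + (k j - x j + M) / eta t.
    by apply: le_trans (HS j) _; rewrite lerD2l ler_wpM2l.
  rewrite /infeasible_loss /fpl_loss; case E : leader => [j|] /=.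
    (* The induction bound is used at the leader j itself: its new loss completes its own score,
       which is at most the score of any i. *)
    have [/(_ i) ji _] := (leaderE _ _).1 E.
    have := HS' j; move: ji; lra.
  have := HS' i; have /andP[] := s01 i t1T; lra.
elim: m => // m IH /andP[_ mT] i; rewrite big_nat_recr//=.
case: m => [|m] in IH mT *.
  rewrite big_geq//; apply: (step 1%N 0 0) => //.
    by rewrite invr_ge0 ltW// eta_gt0// mT.
  by move=> j; rewrite mulr0 addr0 /cumulative big_geq.
apply: (step m.+2 _ (eta m.+1)^-1); rewrite ?mT//; last by apply: IH; exact: ltnW.
by rewrite lef_pV2 ?posrE ?eta_gt0 ?eta_decr ?(ltnW mT).
Qed.

Variable nu : probability (prod_space (expert n) R) R.
Hypothesis nu_iid : iid_exponential nu.
Hypothesis k_ge0 : forall i, 0 <= k i.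
Hypothesis k_kraft : (\esum_(i in [set: expert n]) (expR (- k i))%:E <= 1)%E.

(* Integrating be_the_leader: the expected excess is at most sum_j e^(-k_j) <= 1,
   which is absorbed by the mean 1 of x_i. *)
Lemma infeasible_regret m i : (1 <= m <= T)%N ->
  (\sum_(1 <= t < m.+1) \int[nu]_x (infeasible_loss t x)%:E <=
   (cumulative m.+1 i + k i / eta m)%:E)%E.
Proof.
move=> m1T; have em := eta_gt0 m1T.
have il0 t x : (1 <= t <= m)%N -> 0 <= infeasible_loss t x.
  move=> /andP[t1 tm]; have t1T : (1 <= t <= T)%N.
    by rewrite t1 (leq_trans tm)//; case/andP: m1T.
  by case/andP: (fpl_loss_ge0 k (fun i => cumulative t i + s t i) (eta t) x
    (fun j => s01 j t1T)).
have cum0 : 0 <= cumulative m.+1 i.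
  rewrite /cumulative big_nat_cond; apply: sumr_ge0 => t /andP[/andP[t1 tm] _].
  have t1T : (1 <= t <= T)%N.
    by rewrite t1 (leq_trans (tm : (t <= m)%N))//; case/andP: m1T.
  by case/andP: (s01 i t1T).
pose S (x : prod_space (expert n) R) : \bar R := (\sum_(1 <= t < m.+1) infeasible_loss t x)%:E.
have S0 x : (0 <= S x)%E.
  rewrite lee_fin big_nat_cond; apply: sumr_ge0 => t /andP[/andP[t1 tm] _].
  by apply: il0; rewrite t1.
(* The positive part of x_i / eta_m, almost surely x_i / eta_m itself. Placed on the left of the
   inequality it keeps both integrands nonnegative; the form x_i - 0 is the excess over 0, whose
   mean is 1. *)
pose X (x : prod_space (expert n) R) : \bar R := ((eta m)^-1%:E * (Num.max 0 (x i - 0))%:E)%E.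
have X0 x : (0 <= X x)%E.
  by rewrite mule_ge0// lee_fin ?invr_ge0 ?(ltW em)// le_max lexx.
pose c := cumulative m.+1 i + k i / eta m.
have c0 : (0 <= c%:E)%E by rewrite lee_fin addr_ge0// divr_ge0// ltW.
pose Y (x : prod_space (expert n) R) : \bar R := ((eta m)^-1%:E * excess k x)%E.
have Y0 x : (0 <= Y x)%E.
  by rewrite mule_ge0 ?excess_ge0// lee_fin invr_ge0 ltW.
have mS : measurable_fun [set: prod_space (expert n) R] S.
  apply/measurable_EFinP; apply: measurable_sum => t.
  exact: measurable_fpl_loss.
have mX' : measurable_fun [set: prod_space (expert n) R]
    (fun x => (Num.max 0 (x i - 0))%:E).
  apply/measurable_EFinP; apply: measurable_maxr => //.
  by apply: measurable_funB => //; exact: measurable_proj.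
have mX : measurable_fun [set: prod_space (expert n) R] X by exact: measurable_funeM.
have mY : measurable_fun [set: prod_space (expert n) R] Y.
  by apply: measurable_funeM; exact: measurable_excess.
have SXY : (\int[nu]_x (S x + X x) <= \int[nu]_x (c%:E + Y x))%E.
  apply: ae_ge0_le_integral => //.
  - by move=> x _; rewrite adde_ge0.
  - exact: emeasurable_funD.
  - by move=> x _; rewrite adde_ge0.
  - exact: emeasurable_funD.
  exists [set x | x i < 0]; split.
  - rewrite -[X in measurable X]setTI.
    by apply: measurable_fun_ltr => //; exact: measurable_proj.
  - have -> : [set x : prod_space (expert n) R | x i < 0] =
        coord_rv nu i @^-1` `]-oo, 0[%classic.
      by apply/seteqP; split=> x /=; rewrite in_itv.
    rewrite -[LHS]/(distribution nu (coord_rv nu i) `]-oo, 0%R[%classic) iid_coord//.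
    rewrite /exponential_prob integral0_eq// => y.
    by rewrite /= in_itv/= => y0; rewrite lt0_exponential_pdf.
  - move=> x /=; apply: contra_notP => /negP; rewrite -leNgt => xi0 _.
    rewrite /S /X /Y subr0 max_r//.
    (* The path bound is applied with [M] the total excess; where that is infinite, so is the
       right-hand side. *)
    case E : (excess k x) (excess_ge k x) (excess_ge0 k x) => [M||] // xM M0.
      rewrite -!EFinM -!EFinD lee_fin.
      have := be_the_leader M0 xM m1T i; rewrite /c; lra.
    by rewrite gt0_muley ?lte_fin ?invr_gt0// addey// leey.
have eX : (\int[nu]_x X x = (eta m)^-1%:E)%E.
  rewrite ge0_integralZl//; last 2 first.
  - by move=> x _; rewrite lee_fin le_max lexx.
  - by rewrite lee_fin invr_ge0 ltW.
  by rewrite integral_excess// oppr0 expR0 mule1.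
have eY : (\int[nu]_x Y x <= (eta m)^-1%:E)%E.
  have e0 : (0 <= (eta m)^-1%:E)%E by rewrite lee_fin invr_ge0 ltW.
  rewrite ge0_integralZl//; last 2 first.
  - exact: measurable_excess.
  - by move=> x _; exact: excess_ge0.
  by rewrite integral_excess_esum// -[leRHS]mule1 lee_wpmul2l.
move: SXY; rewrite !ge0_integralD// eX.
have -> : (\int[nu]_x c%:E = c%:E)%E by have := expectation_cst nu c; rewrite unlock.
have -> : (\int[nu]_x S x = \sum_(1 <= t < m.+1) \int[nu]_x (infeasible_loss t x)%:E)%E.
  rewrite big_add1 big_mkord -ge0_integral_sum//.
  - by apply: eq_integral => x _; rewrite /S big_add1 big_mkord /= sumEFin.
  - by move=> t; apply/measurable_EFinP; exact: measurable_fpl_loss.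
  - by move=> t x _; rewrite lee_fin il0//= ltn_ord.
move=> SX; rewrite -(leeD2rE _ _ (_ : (eta m)^-1%:E \is a fin_num))//.
by apply: (le_trans SX); exact: leeD2l.
Qed.

End BeTheLeader.

(** * Independence of the present perturbation from the past *)

Section LawUniqueness.
Variables (R : realType) (I : countType).

(** Makes the laws of q_1, ..., q_T interchangeable, so that every l_t can be computed with one
    common perturbation. *)
Lemma iid_exponential_unique (nu nu' : probability (prod_space I R) R) :
  iid_exponential nu -> iid_exponential nu' ->
  forall E, measurable E -> nu E = nu' E.
Proof.
move=> iid iid'; apply: (box_measure_unique (@prod_space_cylinders I R)).
  by rewrite (le_lt_trans (probability_le1 _ _)) ?ltry.
move=> s B us sB; have mB i : i \in s -> measurable (B i) by move=> /sB[].
exact: etrans (iid s B us mB) (esym (iid' s B us mB)).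
Qed.

End LawUniqueness.

Section History.
Variables (R : realType) (n : option nat).
Variables (d : measure_display) (Omega : measurableType d).
Variable P : probability Omega R.
Variable q : nat -> expert n -> {RV P >-> R}.

Definition past_coords (t : nat) : set (nat * expert n) :=
  [set p | (1 <= p.1 < t)%N].

(** The carrier remains [Omega] and only the sigma-algebra shrinks, to the one generated by the
    perturbations before time t. Depending on the past only is then ordinary measurability from
    [history t]. *)
Definition history (t : nat) := g_sigma_algebraType
  (coord_cylinders (past_coords t) (fun p (w : Omega) => q p.1 p.2 w)).

Lemma history_cylinders t : @measurable _ (history t) =
  <<s coord_cylinders (past_coords t) (fun p (w : history t) => q p.1 p.2 w) >>.
Proof. by []. Qed.

Lemma measurable_to_history t :
  measurable_fun [set: Omega] (id : Omega -> history t).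
Proof.
apply: (measurability _ (history_cylinders t)).
move=> _ [_ [p [B [_ mB ->]]] <-]; rewrite setTI.
by rewrite -[X in measurable X]setTI; exact: (measurable_funPT (q p.1 p.2)).
Qed.

Lemma measurable_history_coord t tau i : (1 <= tau < t)%N ->
  measurable_fun [set: history t] (fun w => q tau i w).
Proof.
move=> tau1; exact: (measurable_coord (history_cylinders t) (i := (tau, i))).
Qed.

Lemma measurable_history_mono tau t d' (S : measurableType d') (f : Omega -> S) :
  (tau <= t)%N -> measurable_fun [set: history tau] f ->
  measurable_fun [set: history t] f.
Proof.
move=> taut mf.
suff mid : measurable_fun [set: history t] (id : history t -> history tau).
  exact: (measurableT_comp mf mid).
apply: (measurability _ (history_cylinders tau)).
move=> _ [_ [p [B [/andP[p1 ptau] mB ->]]] <-]; rewrite setTI.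
apply: sub_sigma_algebra; exists p, B; split=> //.
by rewrite /past_coords/= p1 (leq_trans ptau).
Qed.

Lemma measurable_past t : measurable_fun [set: history t]
  (fun w => past t (fun tau i => q tau i w)).
Proof.
apply: measurable_to_prod_space => -[tau i]; rewrite /past /=.
case: (boolP (1 <= tau < t)%N) => [t1|_]; last exact: measurable_cst.
exact: measurable_history_coord.
Qed.

Lemma measurable_history_Omega t d' (S : measurableType d') (f : Omega -> S) :
  measurable_fun [set: history t] f -> measurable_fun [set: Omega] f.
Proof.
by move=> mf; exact: (measurableT_comp mf (@measurable_to_history t)).
Qed.

Variable T : nat.
Hypothesis q_exp : perturbations T q.

Lemma measurable_qvec t : measurable_fun [set: Omega]
  (fun w => (fun i => q t i w) : prod_space (expert n) R).
Proof. by apply: measurable_to_prod_space => i; exact: measurable_funPT. Qed.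

Definition qvec t : {RV P >-> prod_space (expert n) R} :=
  mfun_Sub (mem_set (measurable_qvec t)).

Definition law t : probability (prod_space (expert n) R) R := distribution P (qvec t).

Lemma law_iid t : (1 <= t <= T)%N -> iid_exponential (law t).
Proof.
move=> t1T s B us mB; case: q_exp => _ indep expo.
transitivity (P (\bigcap_(i in [set` s]) ((fun w => q t i w) @^-1` B i))) => //.
rewrite (indep t t1T s B us); last by move=> i /mB.
by apply: eq_big_seq => i /mB mBi; exact: expo.
Qed.

(** For fixed [F] both sides are finite measures in [E], so only boxes of past coordinates matter.
    For these, independence of q_1, ..., q_t gives the product once with the factor of time t and
    once without it. *)
Lemma history_independent t E F : (1 <= t <= T)%N ->
  measurable (E : set (history t)) -> measurable F ->
  P (E `&` qvec t @^-1` F) = (P E * law t F)%E.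
Proof.
move=> t1T mE mF.
have mqF : measurable (qvec t @^-1` F).
  by rewrite -[X in measurable X]setTI; exact: measurable_qvec.
pose idh : {mfun Omega >-> history t} := mfun_Sub (mem_set (@measurable_to_history t)).
pose m1 := (pushforward (mrestr P mqF) idh : {measure set (history t) -> \bar R}).
pose lF := NngNum (fine_ge0 (measure_ge0 (law t) F)).
pose m2 : {measure set (history t) -> \bar R} := mscale lF (distribution P idh).
have lFE : (lF%:num)%:E = law t F.
  by rewrite /= fineK// fin_num_measure.
have -> : P (E `&` qvec t @^-1` F) = m1 (@measurable_to_history t) E by [].
have -> : (P E * law t F)%E = m2 E by rewrite muleC -lFE.
apply: (box_measure_unique (history_cylinders t)) => //.
  by apply: (@le_lt_trans _ _ (P (qvec t @^-1` F)));
    [apply: le_measure; rewrite ?inE// setTI|rewrite (le_lt_trans (probability_le1 _ _)) ?ltry].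
move=> s B us sB; case: q_exp => indep _ _.
(* The constraints of the box are regrouped by time, since independence is assumed between the whole
   vectors q_tau. *)
pose C tau : set (prod_space (expert n) R) :=
  [set x | forall p, p \in s -> p.1 = tau -> B p (x p.2)].
have mC tau : measurable (C tau).
  rewrite (_ : C tau = \bigcap_(p in [set p | p \in s /\ p.1 = tau])
      ((fun x => x p.2) @^-1` B p)).
    apply: fin_bigcap_measurable.
      by apply: (sub_finite_set (B := [set` s])) => [p []//|]; exact: finite_seq.
    move=> p [/sB[_ mB] _]; rewrite -[X in measurable X]setTI.
    exact: (measurable_proj p.2 measurableT mB).
  by apply/seteqP; split=> x xC p; [move=> [ps pt]; exact: xC|move=> ps pt; exact: xC].
pose Q tau (w : Omega) : prod_space (expert n) R := fun i => q tau i w.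
have boxE : box (fun p (w : history t) => q p.1 p.2 w) s B =
    \bigcap_(tau in [set` index_iota 1 t]) (Q tau @^-1` C tau).
  apply/seteqP; split=> w wB.
    by move=> tau _ p ps <-; exact: wB.
  move=> p ps; apply: (wB p.1) => //=; rewrite mem_index_iota.
  by case: (sB _ ps).
pose C' tau := if tau == t then F else C tau.
have tnotin : t \notin index_iota 1 t by rewrite mem_index_iota ltnn andbF.
have boxE' : box (fun p (w : history t) => q p.1 p.2 w) s B `&` qvec t @^-1` F =
    \bigcap_(tau in [set` t :: index_iota 1 t]) (Q tau @^-1` C' tau).
  rewrite boxE; apply/seteqP; split=> w /=.
    move=> [wB wF] tau; rewrite /= inE /C'; case: eqP => [->//|_] /= tt.
    exact: wB.
  move=> wC; split.
    move=> tau tt; have := wC tau; rewrite /= inE tt orbT => /(_ isT).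
    by rewrite /C'; case: eqP => // tauE; rewrite /= tauE (negPf tnotin) in tt.
  by have := wC t; rewrite /= mem_head /C' eqxx => /(_ isT).
have tT tau : tau \in index_iota 1 t -> (1 <= tau <= T)%N.
  rewrite mem_index_iota => /andP[-> taut] /=.
  by rewrite (leq_trans (ltnW taut))//; case/andP: t1T.
have -> : m1 (@measurable_to_history t) (box (fun p (w : history t) => q p.1 p.2 w) s B) =
    (\prod_(tau <- t :: index_iota 1 t) P (Q tau @^-1` C' tau))%E.
  transitivity (P (box (fun p (w : history t) => q p.1 p.2 w) s B `&` qvec t @^-1` F)) => //.
  rewrite boxE'; apply: indep; first by rewrite /= tnotin iota_uniq.
  move=> tau; rewrite inE /C'; case: eqP => [->|_ /= /tT]; by split.
rewrite big_cons {1}/C' eqxx.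
have -> : (\prod_(tau <- index_iota 1 t) P (Q tau @^-1` C' tau) =
    \prod_(tau <- index_iota 1 t) P (Q tau @^-1` C tau))%E.
  apply: eq_big_seq => tau tt; rewrite /C'; case: eqP => // tauE.
  by rewrite tauE (negPf tnotin) in tt.
rewrite -(indep (index_iota 1 t) C); last 2 first.
- exact: iota_uniq.
- by move=> tau /tT.
by rewrite -boxE /m2 /= /mscale lFE.
Qed.

End History.

Lemma measurable_inv_gt0 (R : realType) (d : measure_display)
    (T : measurableType d) (f : T -> R) : (forall w, 0 < f w) ->
  measurable_fun [set: T] f -> measurable_fun [set: T] (fun w => (f w)^-1).
Proof.
move=> f0 mf; rewrite (_ : (fun w => _) = (fun w => expR (- ln (f w)))).
  apply: measurableT_comp => //; apply: measurableT_comp => //.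
  exact: measurableT_comp.
by apply/funext => w; rewrite expRN lnK// posrE.
Qed.

Section FrozenPast.
Variables (R : realType) (n : option nat).
Variables (d : measure_display) (Omega : measurableType d).
Variable P : probability Omega R.
Variables (T : nat) (q : nat -> expert n -> {RV P >-> R}).
Hypothesis q_exp : perturbations T q.

(** Independence makes the joint law of the past and q_t a product, and Tonelli integrates q_t out
    with the past frozen. The measurability of the inner integral is kept because later rates are
    built from it. *)
Lemma expectation_frozen t (F : Omega -> prod_space (expert n) R -> R) :
  (1 <= t <= T)%N -> (forall w x, 0 <= F w x) ->
  measurable_fun [set: history q t * prod_space (expert n) R]
    (fun z => F z.1 z.2) ->
  measurable_fun [set: history q t] (fun w => \int[law q t]_x (F w x)%:E)%E /\
  (\int[P]_w (F w (qvec q t w))%:E = \int[P]_w \int[law q t]_x (F w x)%:E)%E.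
Proof.
move=> t1T F0 mF.
pose mh := @measurable_to_history R n d Omega P q t.
pose idh : {mfun Omega >-> history q t} := mfun_Sub (mem_set mh).
have mj : measurable_fun [set: Omega]
    (fun w => ((w : history q t), qvec q t w)).
  by apply: measurable_fun_pair => //; exact: measurable_funPT.
pose j : {mfun Omega >-> (history q t * prod_space (expert n) R)%type} :=
  mfun_Sub (mem_set mj).
have mF' : measurable_fun [set: history q t * prod_space (expert n) R]
    (fun z => (F z.1 z.2)%:E) by exact/measurable_EFinP.
have mI : measurable_fun [set: history q t] (fun w => \int[law q t]_x (F w x)%:E)%E.
  have F0' z : (0 <= (F z.1 z.2)%:E)%E by rewrite lee_fin.
  have := measurable_fun_fubini_tonelli_F (m2 := law q t) _ mF' F0'.
  exact.
split=> //.
transitivity (\int[distribution P j]_z (F z.1 z.2)%:E)%E.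
  by rewrite ge0_integral_distribution// => z; rewrite lee_fin.
transitivity (\int[distribution P idh \x law q t]_z (F z.1 z.2)%:E)%E.
  apply: eq_measure_integral => E mE _; apply/esym.
  apply: product_measure_unique => // A B mA mB.
  by apply: (etrans _ (history_independent q_exp t1T mA mB)).
rewrite fubini_tonelli1//; last by move=> z; rewrite lee_fin.
rewrite /fubini_F/= ge0_integral_distribution// => w.
by apply: integral_ge0 => x _; rewrite lee_fin.
Qed.

End FrozenPast.

(** * Actual and conditional expected losses against an adaptive adversary *)

Section AdaptiveAdversary.
Variables (R : realType) (n : option nat).
Variables (d : measure_display) (Omega : measurableType d).
Variable P : probability Omega R.
Variables (T : nat) (q : nat -> expert n -> {RV P >-> R}).
Hypothesis q_exp : perturbations T q.
Variable A : nat -> prod_space (nat * expert n) R -> prod_space (expert n) R.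
Hypothesis A_adv : adversary T A.
Variable k : expert n -> R.

Let s := losses A q.

Lemma losses01 t w i : (1 <= t <= T)%N -> 0 <= s t w i <= 1.
Proof. by move=> /A_adv[_]; exact. Qed.

Lemma measurable_losses t i : (1 <= t <= T)%N ->
  measurable_fun [set: history q t] (fun w => s t w i).
Proof.
move=> /A_adv[mA _].
exact: (measurableT_comp (measurable_proj i)
  (measurableT_comp mA (@measurable_past _ _ _ _ _ q t))).
Qed.

Lemma measurable_loss_before t i : (t <= T.+1)%N ->
  measurable_fun [set: history q t] (fun w => loss_before s t w i).
Proof.
case: t => [_|t tT].
  rewrite (_ : (fun w => _) = cst 0); first exact: measurable_cst.
  by apply/funext => w; rewrite /loss_before big_geq.
rewrite (_ : (fun w => _) = (fun w => \sum_(tau < t) s tau.+1 w i)); last first.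
  by apply/funext => w; rewrite /loss_before big_add1 big_mkord.
apply: measurable_sum => tau.
have tau1T : (1 <= tau.+1 <= T)%N by rewrite /= (leq_trans (ltn_ord tau)).
by apply: (measurable_history_mono _ (measurable_losses i tau1T)); rewrite ltnS ltnW.
Qed.

Section OneStep.
Variables (eta : nat -> Omega -> R) (t : nat).
Hypothesis t1T : (1 <= t <= T)%N.

Let F w (x : prod_space (expert n) R) :=
  fpl_loss k (loss_before s t w) (s t w) (eta t w) x.

Let F01 w x : 0 <= F w x <= 1.
Proof. by apply: fpl_loss_ge0 => i; exact: losses01. Qed.

Let F0 w x : 0 <= F w x. Proof. by case/andP: (F01 w x). Qed.

(** The measure is left free because the lemma serves twice: with the law of q_t for measurability
    and expectation, and with the law of q_1, shared by all rounds, for the regret. *)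
Lemma integral_fpl_loss w (nu : probability (prod_space (expert n) R) R) :
  iid_exponential nu ->
  (\int[nu]_x (F w x)%:E)%E = (expected_loss k s q eta t w)%:E.
Proof.
move=> nu_iid.
have mF : measurable_fun [set: prod_space (expert n) R] (fun x => (F w x)%:E).
  by apply/measurable_EFinP; exact: measurable_fpl_loss.
have EF : (\int[nu]_x (F w x)%:E)%E = 'E_P[fun w' => F w (qvec q t w')]%E.
  rewrite unlock -(ge0_integral_distribution (qvec q t) (f := fun x => (F w x)%:E))//; last first.
    by move=> x; rewrite lee_fin.
  apply: eq_measure_integral => E mE _.
  exact: (iid_exponential_unique nu_iid (law_iid q_exp t1T) mE).
rewrite /expected_loss -EF fineK// ge0_fin_numE; last first.
  by apply: integral_ge0 => x _; rewrite lee_fin.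
apply: (@le_lt_trans _ _ (\int[nu]_x (1 : R)%:E)%E).
  apply: ge0_le_integral => //.
    by move=> x _; rewrite lee_fin F0.
  by move=> x _; rewrite lee_fin; case/andP: (F01 w x).
have -> : (\int[nu]_x (1 : R)%:E = 1%:E)%E by have := expectation_cst nu (1 : R); rewrite unlock.
by rewrite ltry.
Qed.

Let law1_iid : iid_exponential (law q t). Proof. exact: (law_iid q_exp t1T). Qed.

Lemma expected_loss01 w : 0 <= expected_loss k s q eta t w <= 1.
Proof.
rewrite -!lee_fin -(integral_fpl_loss w law1_iid).
rewrite integral_ge0; last by move=> x _; rewrite lee_fin.
have <- : (\int[law q t]_x (1 : R)%:E = 1%:E)%E.
  by have := expectation_cst (law q t) (1 : R); rewrite unlock.
apply: ge0_le_integral => //.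
- by move=> x _; rewrite lee_fin.
- by apply/measurable_EFinP; exact: measurable_fpl_loss.
- by move=> x _; rewrite lee_fin; case/andP: (F01 w x).
Qed.

Hypothesis eta_gt0 : forall w, 0 < eta t w.
Hypothesis measurable_eta : measurable_fun [set: history q t] (eta t).

Let measurable_F : measurable_fun [set: history q t * prod_space (expert n) R]
  (fun z => F z.1 z.2).
Proof.
have m1 d' (S : measurableType d') (f : Omega -> S) :
    measurable_fun [set: history q t] f ->
    measurable_fun [set: history q t * prod_space (expert n) R] (fun z => f z.1).
  by move=> mf; exact: (measurableT_comp mf measurable_fst).
apply: measurable_leader_value => i; last exact: (m1 _ _ _ (measurable_losses i t1T)).
apply: measurable_funD.
  apply: (m1 _ _ _ (measurable_loss_before i _)).
  by case/andP: t1T => _ tT; rewrite (leq_trans tT).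
apply: measurable_funM.
  apply: measurable_funB => //.
  exact: (measurableT_comp (measurable_proj i) measurable_snd).
exact: (m1 _ _ _ (measurable_inv_gt0 (T := history q t) eta_gt0 measurable_eta)).
Qed.

Lemma measurable_expected_loss :
  measurable_fun [set: history q t] (expected_loss k s q eta t).
Proof.
apply/measurable_EFinP.
have [mI _] := expectation_frozen q_exp t1T F0 measurable_F.
by apply: eq_measurable_fun mI => w _; rewrite /= integral_fpl_loss.
Qed.

Lemma expectation_actual_loss :
  measurable_fun [set: Omega] (actual_loss k s q eta t) /\
  ('E_P[actual_loss k s q eta t] = 'E_P[expected_loss k s q eta t])%E.
Proof.
split.
  have mj : measurable_fun [set: Omega] (fun w => ((w : history q t), qvec q t w)).
    apply: measurable_fun_pair; last exact: measurable_funPT.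
    exact: (@measurable_to_history _ _ _ _ _ q t).
  exact: (measurableT_comp measurable_F mj).
have [_] := expectation_frozen q_exp t1T F0 measurable_F.
rewrite unlock => ->; apply: eq_integral => w _.
by rewrite integral_fpl_loss.
Qed.

Lemma actual_loss01 w : 0 <= actual_loss k s q eta t w <= 1.
Proof. exact: F01. Qed.

End OneStep.
End AdaptiveAdversary.

(** * From expectations to a frozen sample path *)

Section RegretReduction.
Variables (R : realType) (n : option nat).
Variables (d : measure_display) (Omega : measurableType d).
Variable P : probability Omega R.
Variable k : expert n -> R.
Hypothesis k_ge0 : forall i, 0 <= k i.
Hypothesis k_kraft : (\esum_(i in [set: expert n]) (expR (- k i))%:E <= 1)%E.
Variables (T : nat) (q : nat -> expert n -> {RV P >-> R}).
Hypothesis q_exp : perturbations T q.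
Variable A : nat -> prod_space (nat * expert n) R -> prod_space (expert n) R.
Hypothesis A_adv : adversary T A.
Variable eta : nat -> Omega -> R.

Let s := losses A q.
Let l t w := expected_loss k s q eta t w.

(** With [w] fixed, the losses and rates are plain sequences and a single draw from the law of q_1
    serves every round. The three listed properties are all that is remembered of the infeasible
    leader afterwards. *)
Lemma pathwise_regret w :
  (forall t, (1 <= t <= T)%N -> 0 < eta t w) ->
  (forall t, (1 <= t)%N -> (t < T)%N -> eta t.+1 w <= eta t w) ->
  exists r : nat -> R, [/\
    forall t, (1 <= t <= T)%N -> 0 <= r t <= 1,
    forall t, (1 <= t <= T)%N -> l t w <= expR (eta t w) * r t &
    forall m i, (1 <= m <= T)%N ->
      \sum_(1 <= t < m.+1) r t <= loss_before s m.+1 w i + k i / eta m w].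
Proof.
move=> eta0 etad; have [->|T0] := posnP T.
  by exists (fun=> 0); split=> [[]|[]|[]].
have iid1 : iid_exponential (law q 1) by apply: law_iid q_exp _ _; rewrite T0.
have s01 t i : (1 <= t <= T)%N -> 0 <= s t w i <= 1 by exact: losses01.
pose il t x := infeasible_loss k (fun t => s t w) (fun t => eta t w) t x.
pose r t := fine (\int[law q 1]_x (il t x)%:E).
have il01 t x : (1 <= t <= T)%N -> 0 <= il t x <= 1.
  by move=> t1T; apply: fpl_loss_ge0 => i; exact: s01.
have mil t : measurable_fun [set: prod_space (expert n) R] (fun x => (il t x)%:E).
  by apply/measurable_EFinP; exact: measurable_fpl_loss.
have e1 : (\int[law q 1]_x (1 : R)%:E = 1%:E)%E.
  by have := expectation_cst (law q 1) (1 : R); rewrite unlock.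
have rI t : (1 <= t <= T)%N ->
    [/\ 0 <= \int[law q 1]_x (il t x)%:E,
     \int[law q 1]_x (il t x)%:E <= 1%:E &
     \int[law q 1]_x (il t x)%:E = (r t)%:E]%E.
  move=> t1T.
  have I0 : (0 <= \int[law q 1]_x (il t x)%:E)%E.
    by apply: integral_ge0 => x _; rewrite lee_fin; case/andP: (il01 t x t1T).
  have I1 : (\int[law q 1]_x (il t x)%:E <= 1%:E)%E.
    rewrite -e1; apply: ge0_le_integral => //.
      by move=> x _; rewrite lee_fin; case/andP: (il01 t x t1T).
    by move=> x _; rewrite lee_fin; case/andP: (il01 t x t1T).
  by split=> //; rewrite fineK// ge0_fin_numE// (le_lt_trans I1)// ltry.
exists r; split.
- by move=> t /rI[I0 I1 rE]; rewrite -!lee_fin -rE I0.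
- move=> t t1T; have [_ _ rE] := rI t t1T.
  rewrite -lee_fin EFinM -rE -(integral_fpl_loss q_exp A_adv k eta t1T w iid1).
  by apply: fpl_le_infeasible => // [|i]; [exact: eta0|exact: s01].
- move=> m i m1T.
  have := @infeasible_regret _ _ k (fun t => s t w) (fun t => eta t w) T s01 eta0 etad
    (law q 1) iid1 k_ge0 k_kraft m i m1T.
  rewrite (eq_big_nat _ _ (F2 := fun t => (r t)%:E)); last first.
    move=> t /andP[t1 tm]; have [] := rI t => //.
    by rewrite t1 (leq_trans (tm : (t <= m)%N))//; case/andP: m1T.
  by rewrite sumEFin lee_fin.
Qed.

Hypothesis eta_gt0 : forall t w, (1 <= t <= T)%N -> 0 < eta t w.
Hypothesis measurable_eta : forall t, (1 <= t <= T)%N ->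
  measurable_fun [set: history q t] (eta t).

(** The expectations of u_t and l_t agree round by round, so a bound on l_{1:T} suffices; it is
    asked only almost surely, to match the hypotheses on L in the static case. *)
Lemma expectation_regret (B : Omega -> R) :
  measurable_fun [set: Omega] B -> (forall w, 0 <= B w) ->
  {ae P, forall w, expected_before k s q eta T.+1 w <= B w} ->
  ('E_P[fun w => \sum_(1 <= t < T.+1) actual_loss k s q eta t w]%R <= 'E_P[B])%E.
Proof.
move=> mB B0 lB.
have tT (t : 'I_T) : (1 <= t.+1 <= T)%N by rewrite /= ltn_ord.
have u t := expectation_actual_loss q_exp A_adv k (tT t)
  (fun w => eta_gt0 w (tT t)) (measurable_eta (tT t)).
have u01 t := actual_loss01 q A_adv k eta (tT t).
have ml t := measurable_history_Omega (measurable_expected_loss q_exp A_adv k (tT t)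
  (fun w => eta_gt0 w (tT t)) (measurable_eta (tT t))).
have l01 t := expected_loss01 q_exp A_adv k eta (tT t).
have -> : ('E_P[fun w => \sum_(1 <= t < T.+1) actual_loss k s q eta t w]%R =
    'E_P[fun w => expected_before k s q eta T.+1 w]%R)%E.
  transitivity (\sum_(t < T) 'E_P[actual_loss k s q eta t.+1])%E.
    rewrite unlock -ge0_integral_sum//.
    - by apply: eq_integral => w _; rewrite big_add1 big_mkord sumEFin.
    - by move=> t; apply/measurable_EFinP; case: (u t).
    - by move=> t w _; rewrite lee_fin; case/andP: (u01 t w).
  transitivity (\sum_(t < T) 'E_P[expected_loss k s q eta t.+1])%E.
    by apply: eq_bigr => t _; exact: (proj2 (u t)).
  rewrite expectation.unlock -ge0_integral_sum//.
  - by apply: eq_integral => w _; rewrite /expected_before big_add1 big_mkord sumEFin.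
  - by move=> t; apply/measurable_EFinP.
  - by move=> t w _; rewrite lee_fin; case/andP: (l01 t w).
apply: expectation_le => //.
  rewrite (_ : (fun w => _) = (fun w => \sum_(t < T) expected_loss k s q eta t.+1 w)).
    exact: measurable_sum.
  by apply/funext => w; rewrite /expected_before big_add1 big_mkord.
move=> w; rewrite /expected_before big_add1 big_mkord sumr_ge0// => t _.
by case/andP: (l01 t w).
Qed.

End RegretReduction.

(** * Elementary real inequalities *)

Section RealInequalities.
Variable R : realType.
Implicit Types x y c : R.

(** The function (1 + y + c y^2) e^(-y) has derivative y (2 c - 1 - c y) e^(-y), nonnegative exactly
    up to 2 - 1/c for y >= 0 when that endpoint is nonnegative. The value c = 1 covers [0, 1]. *)
Lemma expR_le_quadratic c x : 0 < c -> 0 <= x -> x <= 2 - c^-1 ->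
  expR x <= 1 + x + c * x ^+ 2.
Proof.
move=> c0 x0 xc.
pose f y : R := (1 + y + c * y ^+ 2) * expR (- y).
suff : f 0 <= f x.
  rewrite /f oppr0 expR0 expr0n/= mulr0 !addr0 mulr1 expRN.
  by rewrite ler_pdivlMr ?expR_gt0// mul1r.
have fE (y : R) : is_derive y 1 f (y * (2 * c - 1 - c * y) * expR (- y)).
  apply: is_derive_eq.
  rewrite /GRing.scale/=; ring.
have fd y : derivable f y 1 by case: (fE y).
apply: (@ger0_derive1_ndecr _ f 0 x) => //.
- move=> y; rewrite in_itv/= => /andP[y0 yx].
  rewrite derive1E; case: (fE y) => _ ->.
  rewrite mulr_ge0 ?expR_ge0// mulr_ge0 ?(ltW y0)//.
  have : c * y <= c * (2 - c^-1) by rewrite ler_pM2l// (le_trans (ltW yx)).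
  by rewrite mulrBr divff ?gt_eqF//; lra.
- by apply: derivable_within_continuous => y _; exact: fd.
Qed.

(** A discrete form of the integral of dX / sqrt X. An increment x = b^2 - a^2 of the partial sums
    has c x = c (b + a)(b - a) <= 2 (b - a), because a <= b and c b <= 1. The hypothesis on [c] is a
    product so that zero sums cause no division. *)
Lemma le_sum_sqrt (x c : nat -> R) (m : nat) :
  (forall t, (1 <= t <= m)%N -> 0 <= x t) ->
  (forall t, (1 <= t <= m)%N -> 0 <= c t) ->
  (forall t, (1 <= t <= m)%N ->
     c t * Num.sqrt (\sum_(1 <= tau < t.+1) x tau) <= 1) ->
  \sum_(1 <= t < m.+1) c t * x t <= 2 * Num.sqrt (\sum_(1 <= t < m.+1) x t).
Proof.
elim: m => [_ _ _|m IH x0 c0 cx]; first by rewrite !big_geq// sqrtr0 mulr0.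
rewrite big_nat_recr//=.
have mm : (1 <= m.+1 <= m.+1)%N by rewrite /= leqnn.
have up t : (1 <= t <= m)%N -> (1 <= t <= m.+1)%N.
  by move=> /andP[-> tm]; rewrite (leq_trans tm).
apply: (@le_trans _ _ (2 * Num.sqrt (\sum_(1 <= t < m.+1) x t) + c m.+1 * x m.+1)).
  by rewrite lerD2r; apply: IH => t /up; [exact: x0|exact: c0|exact: cx].
have X0 : 0 <= \sum_(1 <= t < m.+1) x t.
  by rewrite big_nat_cond sumr_ge0// => t /andP[/andP[t1 tm] _]; rewrite x0// t1 ltnW.
have := cx _ mm; rewrite [X in _ -> _ <= 2 * Num.sqrt X]big_nat_recr//= big_nat_recr//=.
set X := \sum_(1 <= t < m.+1) x t in X0 *.
have xm0 := x0 _ mm; have cm0 := c0 _ mm.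
have a2 := sqr_sqrtr X0; have b2 := sqr_sqrtr (addr_ge0 X0 xm0).
have ab : Num.sqrt X <= Num.sqrt (X + x m.+1) by rewrite ler_wsqrtr// lerDl.
have := sqrtr_ge0 X.
move: ab a2 b2; set a := Num.sqrt X; set b := Num.sqrt (X + _) => ab a2 b2 a0 cb.
have -> : x m.+1 = (b - a) * (b + a) by rewrite -subr_sqr a2 b2; ring.
have : (b - a) * (c m.+1 * (b + a)) <= (b - a) * 2.
  by rewrite ler_wpM2l ?subr_ge0//; nra.
by nra.
Qed.

(** For z = sqrt x the hypothesis is z^2 <= s + D z, which forces z <= D + sqrt s; this is put back
    into the linear term. *)
Lemma le_quadratic_sqrt (x s D : R) : 0 <= x -> 0 <= s -> 0 <= D ->
  x <= s + D * Num.sqrt x -> x <= s + D ^+ 2 + D * Num.sqrt s.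
Proof.
move=> x0 s0 D0; have := sqr_sqrtr x0; have := sqr_sqrtr s0.
have := sqrtr_ge0 x; have := sqrtr_ge0 s.
set z := Num.sqrt x; set a := Num.sqrt s => a0 z0 <- <- h.
have zD : z <= D + a by rewrite leNgt; apply/negP => ?; nra.
nra.
Qed.

End RealInequalities.

(** * Regret inequalities between real sequences *)

Section RegretSequences.
Variables (R : realType) (T : nat) (l r eta : nat -> R).
Hypothesis l01 : forall t, (1 <= t <= T)%N -> 0 <= l t <= 1.
Hypothesis r01 : forall t, (1 <= t <= T)%N -> 0 <= r t <= 1.
Hypothesis eta_gt0 : forall t, (1 <= t <= T)%N -> 0 < eta t.
Hypothesis l_le_r : forall t, (1 <= t <= T)%N -> l t <= expR (eta t) * r t.

Let L := \sum_(1 <= t < T.+1) l t.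
Let S := \sum_(1 <= t < T.+1) r t.

Lemma le_sum_range (f g : nat -> R) :
  (forall t, (1 <= t <= T)%N -> f t <= g t) ->
  \sum_(1 <= t < T.+1) f t <= \sum_(1 <= t < T.+1) g t.
Proof. by move=> fg; apply: ler_sum_nat => t /andP[t1 tT]; apply: fg; rewrite t1. Qed.

Lemma sum_range_ge0 (f : nat -> R) m : (m <= T)%N ->
  (forall t, (1 <= t <= T)%N -> 0 <= f t) -> 0 <= \sum_(1 <= t < m.+1) f t.
Proof.
move=> mT f0; rewrite big_nat_cond sumr_ge0// => t /andP[/andP[t1 tm] _].
by rewrite f0// t1 (leq_trans (tm : (t <= m)%N)).
Qed.

(** Moving the exponential to the side of l_t and using 1 - eta <= e^(-eta) gives l_t <= r_t + eta_t
    l_t for rates of any size. *)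
Lemma sum_expected_le : L <= S + \sum_(1 <= t < T.+1) eta t * l t.
Proof.
rewrite /S -big_split/=; apply: le_sum_range => t tT.
have /andP[l0 _] := l01 tT; have := l_le_r tT.
rewrite -ler_pdivrMl ?expR_gt0// -expRN => h.
have := expR_ge1Dx (- eta t); nra.
Qed.

Lemma static_regret (e M s k : R) : (forall t, (1 <= t <= T)%N -> eta t = e) ->
  0 <= e -> L <= M -> S <= s + k / e -> L <= s + k / e + e * M.
Proof.
move=> etaE e0 LM Ss; apply: (le_trans sum_expected_le).
rewrite lerD//; apply: (@le_trans _ _ (e * L)); last exact: ler_wpM2l.
by rewrite /L big_distrr/=; apply: le_sum_range => t /etaE ->.
Qed.

(** Meant for a prior bound on s_{1:T} instead of l_{1:T}: the error must then be proportional to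
    r_t, at the price of a second-order term and of e <= 1. *)
Lemma static_regret_exp (e : R) : (forall t, (1 <= t <= T)%N -> eta t = e) ->
  0 <= e -> e <= 1 -> L <= (1 + e + e ^+ 2) * S.
Proof.
move=> etaE e0 e1; rewrite /L /S big_distrr/=; apply: le_sum_range => t tT.
apply: (le_trans (l_le_r tT)); rewrite (etaE _ tT).
have /andP[r0 _] := r01 tT; rewrite ler_wpM2r//.
rewrite -[e ^+ 2]mul1r; apply: expR_le_quadratic => //.
by rewrite invr1; lra.
Qed.

Lemma dynamic_regret (C s k : R) :
  (forall t, (1 <= t <= T)%N -> eta t = C / Num.sqrt t%:R) ->
  0 < C -> (1 <= T)%N -> S <= s + k / eta T ->
  L <= s + (k / C + 2 * C) * Num.sqrt T%:R.
Proof.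
move=> etaE C0 T1 Ss; apply: (le_trans sum_expected_le).
have TT : (1 <= T <= T)%N by rewrite T1 leqnn.
have kE : k / eta T = k / C * Num.sqrt T%:R by rewrite etaE// invf_div mulrA mulrAC.
rewrite mulrDl addrA -kE lerD//.
have sumT m : \sum_(1 <= t < m.+1) (1 : R) = m%:R by rewrite sumr_const_nat subn1.
have sqrt0 t : (1 <= t)%N -> 0 < Num.sqrt t%:R :> R by move=> t1; rewrite sqrtr_gt0 ltr0n.
have := @le_sum_sqrt R (fun=> 1) (fun t => (Num.sqrt t%:R)^-1) T.
rewrite sumT => /(_ _ _ _)/wrap[].
- by [].
- by move=> t _; rewrite invr_ge0 sqrtr_ge0.
- by move=> t /andP[t1 _]; rewrite sumT mulVf// gt_eqF// sqrt0.
move=> h; rewrite [2 * C]mulrC -mulrA.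
apply: (le_trans _ (ler_wpM2l (ltW C0) h)).
rewrite big_distrr/=; apply: le_sum_range => t tT; rewrite etaE// mulr1.
rewrite -[leRHS]mulr1 ler_wpM2l//; last by case/andP: (l01 tT).
by rewrite divr_ge0// ?sqrtr_ge0// ltW.
Qed.

(** The added 1 in the rate dominates the current loss, so l_{<t} + 1 >= l_{1:t} and the errors sum
    to at most 2 C sqrt L. What remains is a quadratic inequality in sqrt(L + 1). *)
Lemma self_confident_regret (C D s k : R) :
  (forall t, (1 <= t <= T)%N ->
     eta t = C / Num.sqrt (\sum_(1 <= tau < t) l tau + 1)) ->
  0 < C -> 0 <= k -> 0 <= s -> (1 <= T)%N -> S <= s + k / eta T ->
  k / C + 2 * C <= D ->
  L <= s + D ^+ 2 + D * Num.sqrt (s + 1).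
Proof.
move=> etaE C0 k0 s0 T1 Ss kCD.
have TT : (1 <= T <= T)%N by rewrite T1 leqnn.
have L0 : 0 <= L by apply: sum_range_ge0 => // t /l01/andP[].
have lb t : (1 <= t <= T)%N -> 0 <= \sum_(1 <= tau < t) l tau.
  by case: t => // t /andP[_ tT]; apply: sum_range_ge0 => [|u /l01/andP[]//]; exact: ltnW.
have h1 : \sum_(1 <= t < T.+1) eta t * l t <= 2 * C * Num.sqrt L.
  have := @le_sum_sqrt R l (fun t => (Num.sqrt (\sum_(1 <= tau < t) l tau + 1))^-1) T.
  move=> /(_ _ _ _)/wrap[].
  - by move=> t /l01/andP[].
  - by move=> t _; rewrite invr_ge0 sqrtr_ge0.
  - move=> t tT; have sl := lb _ tT; have [t1 _] := andP tT.
    rewrite mulrC ler_pdivrMr ?mul1r; last by rewrite sqrtr_gt0; lra.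
    rewrite ler_wsqrtr// big_nat_recr//= lerD2l; by case/andP: (l01 tT).
  move=> h; rewrite [2 * C]mulrC -mulrA.
  apply: (le_trans _ (ler_wpM2l (ltW C0) h)).
  by rewrite big_distrr/=; apply: le_sum_range => t tT; rewrite etaE// mulrA.
have h2 : k / eta T <= k / C * Num.sqrt (L + 1).
  rewrite etaE// invf_div mulrA mulrAC ler_wpM2l//; first by rewrite divr_ge0// ltW.
  by rewrite ler_wsqrtr// lerD2r /L big_nat_recr//= lerDl; case/andP: (l01 TT).
have h3 : Num.sqrt L <= Num.sqrt (L + 1) by rewrite ler_wsqrtr// lerDl.
have kC : 0 <= k / C by rewrite divr_ge0// ltW.
have D0 : 0 <= D by apply: le_trans kCD; rewrite addr_ge0// mulr_ge0// ltW.
have LE := sum_expected_le.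
have := @le_quadratic_sqrt R (L + 1) (s + 1) D.
move=> /(_ _ _ _ _)/wrap[] => //; rewrite ?addr_ge0//; last by lra.
have q0 := sqrtr_ge0 (L + 1).
have : (k / C + 2 * C) * Num.sqrt (L + 1) <= D * Num.sqrt (L + 1) by rewrite ler_wpM2r.
have : 2 * C * Num.sqrt L <= 2 * C * Num.sqrt (L + 1).
  by rewrite ler_wpM2l// mulr_ge0// ltW.
rewrite mulrDl; lra.
Qed.

(** The hypothesis gives y_t^2 / 2 >= r_{1:t} and y_t >= 1, so e^(eta_t) <= 1 + 2 / y_t, and the
    weights sqrt 2 / y_t are admissible in [le_sum_sqrt]. *)
Lemma best_loss_regret (y : nat -> R) :
  (forall t, (1 <= t <= T)%N -> [/\ eta t = (y t)^-1, 0 < y t &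
     \sum_(1 <= tau < t) r tau + 1 <= y t ^+ 2 / 2]) ->
  L <= S + 2 * Num.sqrt (2 * S).
Proof.
move=> Hy.
have rb t : (1 <= t <= T)%N -> 0 <= \sum_(1 <= tau < t) r tau.
  by case: t => // t /andP[_ tT]; apply: sum_range_ge0 => [|u /r01/andP[]//]; exact: ltnW.
have S0 : 0 <= S by apply: sum_range_ge0 => // t /r01/andP[].
have s2 : 0 <= Num.sqrt 2 :> R by exact: sqrtr_ge0.
have s22 : Num.sqrt 2 ^+ 2 = 2 :> R by rewrite sqr_sqrtr.
have := @le_sum_sqrt R r (fun t => Num.sqrt 2 * (y t)^-1) T.
move=> /(_ _ _ _)/wrap[].
- by move=> t /r01/andP[].
- by move=> t /Hy[_ y0 _]; rewrite mulr_ge0// invr_ge0 ltW.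
- move=> t tT; have [_ y0 ry] := Hy t tT; have [t1 _] := andP tT.
  rewrite mulrAC ler_pdivrMr// mul1r -sqrtrM//.
  have -> : y t = Num.sqrt (y t ^+ 2) by rewrite sqrtr_sqr ger0_norm// ltW.
  by rewrite ler_wsqrtr// big_nat_recr//=; have /andP[_ r1] := r01 tT; lra.
move=> h; rewrite sqrtrM//.
have : L <= S + Num.sqrt 2 * \sum_(1 <= t < T.+1) Num.sqrt 2 * (y t)^-1 * r t.
  rewrite /S big_distrr/= -big_split/=; apply: le_sum_range => t tT.
  have [yE y0 ry] := Hy t tT; have /andP[r0 _] := r01 tT; have rt := rb t tT.
  apply: (le_trans (l_le_r tT)).
  rewrite !mulrA -expr2 s22 yE -[X in X + _]mul1r -mulrDl ler_wpM2r//.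
  have u0 : 0 < (y t)^-1 by rewrite invr_gt0.
  have yu : y t * (y t)^-1 = 1 by rewrite divff// gt_eqF.
  have y1 : 1 <= y t by nra.
  have u1 : (y t)^-1 <= 1 by rewrite invf_le1.
  apply: (@le_trans _ _ (1 + (y t)^-1 + 1 * (y t)^-1 ^+ 2)).
    by apply: expR_le_quadratic => //; rewrite ?invr1; lra.
  by nra.
have := ler_wpM2l s2 h; nra.
Qed.

(* The right-hand side is an increment of the potential
   K z / 2 + 2 K ln z - 1 / z - 1 / z^2 - 2 K / z. *)
Lemma abel_step (K z z' : R) : 0 < K -> 0 < z -> z <= z' ->
  K * (z' ^+ 2 - z ^+ 2) <= 2 ->
  (z^-1 + z^-1 ^+ 2 - z'^-1 - z'^-1 ^+ 2) * (K * z' ^+ 2 / 2 + K * z) <=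
  K * (z' - z) / 2 + 2 * K * (ln z' - ln z) + (z^-1 - z'^-1)
   + (z^-1 ^+ 2 - z'^-1 ^+ 2) + 2 * K * (z^-1 - z'^-1).
Proof.
move=> K0 z0 zz' Kz; have z'0 : 0 < z' by exact: lt_le_trans zz'.
have lnE (a b : R) : 0 < a -> 0 < b -> (b - a) / b <= ln b - ln a.
  move=> a0 b0; have := @le_ln1Dx R (a / b - 1).
  rewrite addrCA subrr addr0 ln_div ?posrE// => /(_ _)/wrap[].
    by rewrite ltrBrDr addNr divr_gt0.
  by rewrite mulrBl divff ?gt_eqF//; lra.
have g := lnE _ _ z0 z'0.
have h : (z' ^+ 2 - z ^+ 2) / z' ^+ 2 <= 2 * (ln z' - ln z).
  by have := lnE _ _ (exprn_gt0 2 z0) (exprn_gt0 2 z'0); rewrite !lnXn//; lra.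
have zn0 : z != 0 by rewrite gt_eqF.
have zn0' : z' != 0 by rewrite gt_eqF.
have dz : 0 <= z' - z by rewrite subr_ge0.
(* The logarithmic term is spent in two equal halves: [E1] treats the terms in 1/z with the bound on
   ln z' - ln z, and [E2] those in 1/z^2 with the bound for the logarithms of the squares. The limit
   on z'^2 - z^2 makes both right-hand sides nonnegative. *)
have E1 : K * (z' - z) / 2 + K * ((z' - z) / z') + (z^-1 - z'^-1)
    - (z^-1 - z'^-1) * (K * z' ^+ 2 / 2 + K * z) =
    (z' - z) / (z * z') * (1 - K * z' * (z' - z) / 2).
  by field; rewrite zn0 zn0'.
have E2 : K / 2 * ((z' ^+ 2 - z ^+ 2) / z' ^+ 2) * 1 + (z^-1 ^+ 2 - z'^-1 ^+ 2)
    + 2 * K * (z^-1 - z'^-1)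
    - (z^-1 ^+ 2 - z'^-1 ^+ 2) * (K * z' ^+ 2 / 2 + K * z) =
    (z' - z) / (z * z') ^+ 2 * ((z' + z) * (1 - K * (z' ^+ 2 - z ^+ 2) / 2) + K * z * (z' - z)).
  by field; rewrite zn0 zn0'.
have P1 : 0 <= (z' - z) / (z * z') * (1 - K * z' * (z' - z) / 2).
  apply: mulr_ge0; first by rewrite divr_ge0// mulr_ge0 ?ltW.
  have : K * z' * (z' - z) <= K * (z' ^+ 2 - z ^+ 2).
    rewrite -subr_ge0 (_ : _ - _ = K * (z * (z' - z))); last by ring.
    by rewrite mulr_ge0 ?(ltW K0)// mulr_ge0// ltW.
  lra.
have P2 : 0 <= (z' - z) / (z * z') ^+ 2 *
    ((z' + z) * (1 - K * (z' ^+ 2 - z ^+ 2) / 2) + K * z * (z' - z)).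
  apply: mulr_ge0; first by rewrite divr_ge0// exprn_ge0// mulr_ge0 ?ltW.
  apply: addr_ge0; last by rewrite mulr_ge0// mulr_ge0 ?ltW.
  by apply: mulr_ge0; [rewrite addr_ge0 ?ltW|lra].
have G := ler_wpM2l (ltW K0) g; have H := ler_wpM2l (ltW K0) h.
rewrite -E1 in P1; rewrite -E2 in P2.
move: P1 P2 G H.
set a := (z' - z) / z'; set b := (_ / z' ^+ 2); set u := z^-1; set v := z'^-1.
nra.
Qed.

End RegretSequences.

(** * The logarithmic bound for rates driven by the best past loss *)

Section LogarithmicRegret.
Variables (R : realType) (T : nat) (l r eta M : nat -> R) (K s : R).
Hypothesis T_ge1 : (1 <= T)%N.
Hypothesis K_gt0 : 0 < K.
Hypothesis r01 : forall t, (1 <= t <= T)%N -> 0 <= r t <= 1.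
Hypothesis l_le_r : forall t, (1 <= t <= T)%N -> l t <= expR (eta t) * r t.
Hypothesis M1 : M 1 = 0.
Hypothesis M_step : forall t, (1 <= t <= T)%N -> M t <= M t.+1 <= M t + 1.
Hypothesis M_le_s : M T.+1 <= s.

Let z t := Num.sqrt 2 * Num.max 1 (Num.sqrt (M t / K)).

Hypothesis etaE : forall t, (1 <= t <= T)%N -> eta t = (z t)^-1.
Hypothesis sum_r_le : forall m, (1 <= m <= T)%N ->
  \sum_(1 <= t < m.+1) r t <= M m.+1 + K * z m.

Let rho m := \sum_(1 <= t < m.+1) r t.

Let M_mono a b : (1 <= a)%N -> (a <= b)%N -> (b <= T.+1)%N -> M a <= M b.
Proof.
move=> a1; elim: b => [|b IH]; first by rewrite leqn0 => /eqP a0; rewrite a0 in a1.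
rewrite leq_eqVlt => /predU1P[->//|ab] bT.
have := M_step (t := b); rewrite (leq_trans a1 ab)/= => /(_ bT)/andP[h _].
exact: le_trans (IH ab (ltnW bT)) h.
Qed.

Let M_ge0 t : (1 <= t <= T.+1)%N -> 0 <= M t.
Proof. by move=> /andP[t1 tT]; rewrite -M1 M_mono. Qed.

Let sqrt2_gt0 : 0 < Num.sqrt 2 :> R. Proof. by rewrite sqrtr_gt0. Qed.
Let sqr_sqrt2 : Num.sqrt 2 ^+ 2 = 2 :> R. Proof. by rewrite sqr_sqrtr. Qed.

Let sqrt2_inv : Num.sqrt 2 = 2 * (Num.sqrt 2)^-1 :> R.
Proof.
have -> : 2 * (Num.sqrt 2)^-1 = Num.sqrt 2 ^+ 2 * (Num.sqrt 2)^-1 :> R by rewrite sqr_sqrt2.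
by rewrite expr2 -mulrA divff ?mulr1// gt_eqF.
Qed.

Let z_ge t : Num.sqrt 2 <= z t.
Proof. by rewrite -[leLHS]mulr1 ler_wpM2l ?sqrtr_ge0// le_max lexx. Qed.

Let z_gt0 t : 0 < z t. Proof. exact: lt_le_trans sqrt2_gt0 (z_ge t). Qed.

Let z_sqr t : (1 <= t <= T.+1)%N -> K * z t ^+ 2 = 2 * Num.max K (M t).
Proof.
move=> /M_ge0 Mt0; rewrite exprMn sqr_sqrt2.
have w0 : 0 <= M t / K by rewrite divr_ge0// ltW.
have -> : Num.max 1 (Num.sqrt (M t / K)) ^+ 2 = Num.max 1 (M t / K).
  have -> : Num.max 1 (Num.sqrt (M t / K)) = Num.sqrt (Num.max 1 (M t / K)).
    rewrite -[X in Num.max X _]sqrtr1.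
    have [h|h] := leP 1 (M t / K); first by rewrite max_r// ler_wsqrtr.
    by rewrite max_l// ler_wsqrtr// ltW.
  by rewrite sqr_sqrtr// le_max ler01.
rewrite mulrCA; congr (_ * _).
by rewrite maxr_pMr ?(ltW K_gt0)// mulr1 mulrCA divff ?mulr1// gt_eqF.
Qed.

Let z_mono t : (1 <= t <= T)%N -> z t <= z t.+1.
Proof.
move=> tT; rewrite ler_wpM2l ?sqrtr_ge0// ge_max le_max lexx /= le_max.
by rewrite ler_wsqrtr ?orbT// ler_wpM2r ?invr_ge0 ?(ltW K_gt0)//; case/andP: (M_step tT).
Qed.

(** K z_t^2 / 2 is max(K, M_t), and clipping from below does not enlarge an increment of at most
    1. *)
Let z_step t : (1 <= t <= T)%N -> K * (z t.+1 ^+ 2 - z t ^+ 2) <= 2.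
Proof.
move=> tT; have /andP[t1 tT'] := tT.
rewrite mulrBr !z_sqr ?t1 ?(leq_trans tT')//.
have /andP[h1 h2] := M_step tT.
have : Num.max K (M t.+1) <= Num.max K (M t) + 1.
  rewrite ge_max; have : K <= Num.max K (M t) by rewrite le_max lexx.
  have : M t <= Num.max K (M t) by rewrite le_max lexx orbT.
  by move=> *; apply/andP; split; lra.
lra.
Qed.

Let r_ge0 t : (1 <= t <= T)%N -> 0 <= r t. Proof. by move=> /r01/andP[]. Qed.

Let f t := (z t)^-1 + (z t)^-1 ^+ 2.
(** For f = 1/z + 1/z^2, the continuous counterpart of the sum by parts is the integral of (1/z^2 +
    2/z^3)(K z^2 / 2 + K z), namely K z / 2 + 2 K ln z - 2 K / z. The terms - 1/z and - 1/z^2 pay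
    for the discrete steps. *)
Let Phi x := K * x / 2 + 2 * K * ln x - x^-1 - x^-1 ^+ 2 - 2 * K * x^-1.

(* Summation by parts of f_t r_t against the cumulative losses rho_t, which are
   bounded through sum_r_le in terms of z alone. *)
Let abel m : (1 <= m <= T)%N ->
  \sum_(1 <= t < m.+1) f t * r t <= f m * rho m + (Phi (z m) - Phi (z 1)).
Proof.
case: m => // m; elim: m => [_|m IH mT].
  by rewrite /rho !big_nat1 subrr addr0.
have mT' : (1 <= m.+1 <= T)%N by rewrite /=; exact: ltnW.
have -> : rho m.+2 = rho m.+1 + r m.+2 by rewrite /rho big_nat_recr.
rewrite big_nat_recr//=.
have := abel_step K_gt0 (z_gt0 m.+1) (z_mono mT') (z_step mT').
have rhoz : rho m.+1 <= K * z m.+2 ^+ 2 / 2 + K * z m.+1.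
  apply: (le_trans (sum_r_le mT')); rewrite lerD2r z_sqr; last by rewrite /= ltnW.
  by rewrite mulrAC divff// mul1r le_max lexx orbT.
have fd : 0 <= f m.+1 - f m.+2.
  rewrite subr_ge0; have h : (z m.+2)^-1 <= (z m.+1)^-1.
    by rewrite lef_pV2 ?posrE ?z_gt0// z_mono.
  have h0 : 0 <= (z m.+2)^-1 by rewrite invr_ge0 ltW ?z_gt0.
  by rewrite lerD// lerXn2r// nnegrE// (le_trans h0).
have := ler_wpM2l fd rhoz.
have := IH mT'; rewrite /Phi /f.
lra.
Qed.

Let sum_le_one_plus_f : \sum_(1 <= t < T.+1) l t <=
  rho T + \sum_(1 <= t < T.+1) f t * r t.
Proof.
rewrite /rho -big_split/=; apply: le_sum_range => t tT.
apply: (le_trans (l_le_r tT)); rewrite etaE// -[X in X + _]mul1r -mulrDl.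
rewrite ler_wpM2r ?r_ge0// /f addrA -[X in _ + X]mul1r expR_le_quadratic//.
  by rewrite invr_ge0 ltW.
rewrite invr1 (_ : 2 - 1 = 1); last by ring.
rewrite invf_le1// (le_trans _ (z_ge t))//.
by rewrite -[leLHS]sqrtr1 ler_wsqrtr// ler1n.
Qed.

Let TT : (1 <= T <= T)%N. Proof. by rewrite T_ge1 leqnn. Qed.

(* The rates are constant here; the bound e^(1/sqrt 2) <= 3 / sqrt 2 is needed,
   for which 1 + x + x^2 is too weak. *)
Lemma small_best_loss_regret : M T <= K ->
  \sum_(1 <= t < T.+1) l t <= s + 2 * Num.sqrt (2 * K * s) + 3 * K + 6.
Proof.
move=> MK.
have zE t : (1 <= t <= T)%N -> z t = Num.sqrt 2.
  move=> /andP[t1 tT]; rewrite /z max_l ?mulr1// -sqrtr1 ler_wsqrtr//.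
  by rewrite ler_pdivrMr// mul1r (le_trans (M_mono t1 tT _)).
pose x : R := (Num.sqrt 2)^-1.
have x0 : 0 < x by rewrite invr_gt0.
have x2 : x ^+ 2 = 2^-1 by rewrite exprVn sqr_sqrt2.
have sx : Num.sqrt 2 = 2 * x by exact: sqrt2_inv.
have x1 : x <= 3 / 4 - 1 / 26 by rewrite leNgt; apply/negP => ?; nra.
(* For c = 4/5 the quadratic bound reaches up to 3/4, beyond 1 / sqrt 2, and c x^2 = 2/5. *)
have ex : expR x <= 7 / 5 + x.
  apply: (@le_trans _ _ (1 + x + (4 / 5) * x ^+ 2)); last by rewrite x2; lra.
  by apply: expR_le_quadratic; [lra|exact: ltW|rewrite invf_div; lra].
have rho0 : 0 <= rho T by apply: (@sum_range_ge0 _ T).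
have LS : \sum_(1 <= t < T.+1) l t <= (7 / 5 + x) * rho T.
  rewrite big_distrr/=; apply: le_sum_range => t tT.
  apply: (le_trans (l_le_r tT)); rewrite etaE// zE// ler_wpM2r//; exact: r_ge0.
have rS := sum_r_le TT; rewrite -/(rho T) (zE T)// sx in rS.
have MT0 := M_ge0 (t := T); have /andP[Ma Mb] := M_step TT.
have {}MT0 : 0 <= M T by rewrite MT0// T_ge1 leqnSn.
have Ms : M T <= Num.sqrt (2 * K * s).
  have Ms : M T <= s := le_trans Ma M_le_s.
  have a := ler_wpM2r MT0 MK; have b := ler_wpM2l (ltW K_gt0) Ms.
  have c : 0 <= K * M T by rewrite mulr_ge0 ?(ltW K_gt0).
  by rewrite -[leLHS]ger0_norm// -sqrtr_sqr ler_wsqrtr// expr2; lra.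
have h1 : (7 / 5 + x) * rho T <= (7 / 5 + x) * (M T.+1 + K * (2 * x)).
  by rewrite ler_wpM2l//; lra.
have h2 : (7 / 5 + x) * (K * (2 * x)) <= 3 * K.
  have -> : (7 / 5 + x) * (K * (2 * x)) = K * (14 / 5 * x + 2 * x ^+ 2) by field.
  rewrite x2 [3 * K]mulrC ler_wpM2l ?(ltW K_gt0)//; lra.
(* One copy of [M T.+1] is charged to s, and the remaining 6/5 to M_T + 1 <= sqrt(2 K s) + 1. *)
have h3 : (7 / 5 + x) * M T.+1 <= (11 / 5) * M T.+1 by rewrite ler_wpM2r//; lra.
have M's := M_le_s; lra.
Qed.

(** Clipping is inactive at time T, so K z_T^2 = 2 M_T and K z_T <= sqrt(2 K s). The term K z_T
    enters once through rho_T, one half through f_T rho_T and one half through the potential, which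
    explains the factor 2 before the root. *)
Lemma large_best_loss_regret : K < M T ->
  \sum_(1 <= t < T.+1) l t <=
    s + 2 * Num.sqrt (2 * K * s) + K * ln s + 3 * K + 6.
Proof.
move=> KM; have /andP[Ma Mb] := M_step TT.
have TT1 : (1 <= T <= T.+1)%N by rewrite T_ge1 leqnSn.
have z2 := z_sqr TT1; rewrite max_r ?(ltW KM)// in z2.
have z1E : z 1 = Num.sqrt 2 by rewrite /z M1 mul0r sqrtr0 max_l ?ler01// mulr1.
have M0 : 0 < M T by exact: lt_trans KM.
have s0 : 0 < s by exact: lt_le_trans M0 (le_trans Ma M_le_s).
have KzE : K * z T <= Num.sqrt (2 * K * s).
  have Kz0 : 0 <= K * z T by rewrite mulr_ge0 ?(ltW K_gt0)// ltW.
  rewrite -[leLHS]ger0_norm// -sqrtr_sqr ler_wsqrtr//.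
  have -> : (K * z T) ^+ 2 = K * (K * z T ^+ 2) by ring.
  rewrite z2.
  have Ms : M T <= s := le_trans Ma M_le_s.
  by have b := ler_wpM2l (ltW K_gt0) Ms; lra.
(* Since z_1^2 = 2, the difference of logarithms is half of ln(M_T / K), and - K ln K <= 1 - K. *)
have lnE : 2 * K * (ln (z T) - ln (z 1)) <= K * ln s + 1.
  have h : 2 * (ln (z T) - ln (z 1)) = ln (M T) - ln K.
    have -> : M T = K * z T ^+ 2 / 2 by rewrite z2; field.
    have e2 : 2 * ln (z 1) = ln 2.
      by rewrite z1E -[in RHS]sqr_sqrt2 lnXn// mulr2n; ring.
    rewrite ln_div ?posrE ?mulr_gt0 ?exprn_gt0// lnM ?posrE ?exprn_gt0// lnXn//.
    rewrite -e2; ring.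
  have h1 : ln (M T) <= ln s by rewrite ler_ln ?posrE// (le_trans Ma).
  have h2 : - (K * ln K) <= 1.
    have := @le_ln1Dx R (K^-1 - 1); rewrite addrCA subrr addr0 lnV ?posrE// => /(_ _)/wrap[].
      by rewrite ltrBrDr addNr invr_gt0.
    move=> /(ler_wpM2l (ltW K_gt0)); rewrite mulrBr divff ?gt_eqF//.
    by have K0 := K_gt0; lra.
  have := ler_wpM2l (ltW K_gt0) h1; have : K * (2 * (ln (z T) - ln (z 1))) = K * (ln (M T) - ln K) by rewrite h.
  lra.
have LA := le_trans sum_le_one_plus_f (lerD (lexx (rho T)) (abel TT)).
have rS := sum_r_le TT; rewrite -/(rho T) in rS.
set u := (z T)^-1 in LA *.
have u0 : 0 < u by rewrite invr_gt0.
have zu : z T * u = 1 by rewrite divff// gt_eqF.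
have f0 : 0 <= f T by rewrite /f addr_ge0 ?sqr_ge0 ?(ltW u0).
have h1 : (1 + f T) * rho T <= (1 + f T) * (M T.+1 + K * z T).
  by rewrite ler_wpM2l//; lra.
have h2 : f T * M T.+1 <= f T * (K * z T ^+ 2 / 2 + 1).
  by rewrite ler_wpM2l// z2; lra.
have h3 : f T * (K * z T ^+ 2 / 2 + 1) = K * z T / 2 + K / 2 + u + u ^+ 2.
  have -> : f T * (K * z T ^+ 2 / 2 + 1) =
     K * z T / 2 * (z T * u) + K / 2 * (z T * u) ^+ 2 + u + u ^+ 2 by rewrite /f -/u; field.
  by rewrite zu; ring.
have h4 : f T * (K * z T) = K + K * u.
  have -> : f T * (K * z T) = K * (z T * u) + K * u * (z T * u) by rewrite /f -/u; ring.
  by rewrite zu; ring.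
have x1 : (z 1)^-1 ^+ 2 = 2^-1 by rewrite z1E exprVn sqr_sqrt2.
have x2 : z 1 = 2 * (z 1)^-1 by rewrite z1E; exact: sqrt2_inv.
have x0 : 0 < (z 1)^-1 by rewrite invr_gt0.
have x3 : (z 1)^-1 <= 3 / 4 by rewrite leNgt; apply/negP => ?; nra.
have Ku : 0 <= K * u by rewrite mulr_ge0 ?(ltW K_gt0) ?(ltW u0).
have Kx : K * (z 1)^-1 <= K * (3 / 4) by rewrite ler_wpM2l ?(ltW K_gt0).
have x2' : K * z 1 = 2 * (K * (z 1)^-1) by rewrite {1}x2; ring.
have K0 := K_gt0; have M's := M_le_s; move: LA; rewrite /Phi -/u x1.
lra.
Qed.

Lemma best_loss_log_regret : \sum_(1 <= t < T.+1) l t <=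
  s + 2 * Num.sqrt (2 * K * s) + 5 * K * ln_pos s + 3 * K + 6.
Proof.
have ln0 : 0 <= ln_pos s by rewrite ln_ge0// le_max lexx.
have Kl : 0 <= K * ln_pos s by rewrite mulr_ge0 ?(ltW K_gt0).
have [/small_best_loss_regret|KM] := leP (M T) K; first lra.
have s0 : 0 < s.
  by have /andP[Ma _] := M_step TT; exact: lt_le_trans (lt_trans K_gt0 KM) (le_trans Ma M_le_s).
have lns : ln s <= ln_pos s.
  by rewrite /ln_pos ler_ln ?posrE ?le_max ?lexx ?orbT// lt_max ltr01.
have := large_best_loss_regret KM; have := ler_wpM2l (ltW K_gt0) lns; lra.
Qed.

End LogarithmicRegret.

(** * Minimum over the experts *)

Section MinExperts.
Variables (R : realType) (n : option nat) (i0 : expert n).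
Implicit Types c : expert n -> R.

Lemma min_experts_le c i : (forall j, 0 <= c j) -> min_experts c <= c i.
Proof. by move=> c0; apply: ge_inf; [exists 0 => _ [j _ <-]|exists i]. Qed.

Lemma le_min_experts c (x : R) : (forall j, x <= c j) -> x <= min_experts c.
Proof. by move=> xc; apply: lb_le_inf; [exists (c i0), i0|move=> _ [j _ <-]]. Qed.

(** The infimum is below x exactly when some value is, so its strict sublevel sets are countable
    unions. The expert [i0] of the section makes the range nonempty. *)
Lemma measurable_min_experts (d : measure_display) (T : measurableType d)
    (c : T -> expert n -> R) : (forall w j, 0 <= c w j) ->
  (forall j, measurable_fun [set: T] (fun w => c w j)) ->
  measurable_fun [set: T] (fun w => min_experts (c w)).
Proof.
move=> c0 mc; apply: (measurability _ (RGenInftyO.measurableE R)).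
move=> _ [_ [x ->] <-]; rewrite setTI.
rewrite (_ : _ @^-1` _ = \bigcup_j [set w | c w j < x]).
  apply: countable_bigcupT_measurable => // j.
  rewrite -[X in measurable X]setTI.
  exact: (measurable_fun_ltr (mc j) (measurable_cst x)).
apply/seteqP; split=> w /=; rewrite ?in_itv/=.
  move=> cx; apply: contrapT => h; move: cx; rewrite ltNge => /negP; apply.
  by apply: le_min_experts => j; rewrite leNgt; apply/negP => cj; apply: h; exists j.
move=> [j _ /= cj]; apply: le_lt_trans cj; exact: min_experts_le.
Qed.

End MinExperts.

Lemma measurable_sqrt (R : realType) : measurable_fun [set: R] (@Num.sqrt R).
Proof. by apply: continuous_measurable_fun; exact: sqrt_continuous. Qed.

Lemma measurable_fun_sqrt (R : realType) (d : measure_display)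
    (T : measurableType d) (f : T -> R) : measurable_fun [set: T] f ->
  measurable_fun [set: T] (fun x => Num.sqrt (f x)).
Proof. by move=> mf; exact: measurableT_comp (@measurable_sqrt R) mf. Qed.

(** * Transfer of pathwise bounds to expectations *)

Section PathwiseReduction.
Variables (R : realType) (n : option nat).
Variables (d : measure_display) (Omega : measurableType d).
Variable P : probability Omega R.
Variable k : expert n -> R.
Hypothesis k_ge0 : forall i, 0 <= k i.
Hypothesis k_kraft : (\esum_(i in [set: expert n]) (expR (- k i))%:E <= 1)%E.
Variables (T : nat) (q : nat -> expert n -> {RV P >-> R}).
Hypothesis T_ge1 : (1 <= T)%N.
Hypothesis q_exp : perturbations T q.
Variable A : nat -> prod_space (nat * expert n) R -> prod_space (expert n) R.
Hypothesis A_adv : adversary T A.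

Let s := losses A q.

Lemma loss_beforeS t w i : (1 <= t)%N ->
  loss_before s t.+1 w i = loss_before s t w i + s t w i.
Proof. by move=> t1; rewrite /loss_before big_nat_recr. Qed.

Lemma loss_before_step t w i : (1 <= t <= T)%N ->
  loss_before s t w i <= loss_before s t.+1 w i <= loss_before s t w i + 1.
Proof.
move=> tT; have /andP[t1 _] := tT; rewrite loss_beforeS//.
by have /andP[h1 h2] := losses01 q A_adv w i tT; rewrite lerDl lerD2l h1.
Qed.

Lemma loss_before_ge0 t w i : (t <= T.+1)%N -> 0 <= loss_before s t w i.
Proof.
elim: t => [|t IH] tT; first by rewrite /loss_before big_geq.
have [->|t0] := posnP t; first by rewrite /loss_before big_geq.
have tT' : (1 <= t <= T)%N by rewrite t0.
by have /andP[h _] := loss_before_step w i tT'; exact: le_trans (IH (ltnW tT)) h.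
Qed.

(* r_t stands for the expected loss of the infeasible leader, which already
   knows the losses of time t. *)
Definition infeasible_path (eta : nat -> Omega -> R) w (r : nat -> R) := [/\
    forall t, (1 <= t <= T)%N -> 0 <= r t <= 1,
    forall t, (1 <= t <= T)%N ->
      expected_loss k s q eta t w <= expR (eta t w) * r t &
    forall m i, (1 <= m <= T)%N ->
      \sum_(1 <= t < m.+1) r t <= loss_before s m.+1 w i + k i / eta m w].

Lemma expectation_path_bound (eta : nat -> Omega -> R) (g : R -> R) i :
  (forall t, (1 <= t <= T)%N -> forall w, 0 < eta t w) ->
  (forall t, (1 <= t)%N -> (t < T)%N -> forall w, eta t.+1 w <= eta t w) ->
  (forall t, (1 <= t <= T)%N -> measurable_fun [set: history q t] (eta t)) ->
  measurable_fun [set: R] g -> (forall x, 0 <= x -> 0 <= g x) ->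
  {ae P, forall w, forall r, infeasible_path eta w r ->
     expected_before k s q eta T.+1 w <= g (loss_before s T.+1 w i)} ->
  ('E_P[fun w => \sum_(1 <= t < T.+1) actual_loss k s q eta t w]%R <=
   'E_P[fun w => g (loss_before s T.+1 w i)]%R)%E.
Proof.
move=> eta0 etad meta mg g0 lg.
apply: (expectation_regret q_exp A_adv) => //.
- by move=> t w tT; exact: eta0.
- apply: (measurableT_comp mg); apply: measurable_history_Omega.
  exact: (measurable_loss_before A_adv (t := T.+1)).
- by move=> w; apply: g0; exact: loss_before_ge0.
- move: lg; apply: filterS => w lg.
  have [|t t1 tT|r hr] := @pathwise_regret _ _ _ _ P k k_ge0 k_kraft T q q_exp A A_adv eta w.
  + by move=> t tT; exact: eta0.
  + exact: etad.
  + exact: lg hr.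
Qed.

Lemma expectation_static_bound (eta : nat -> Omega -> R) (e : R) (g : R -> R) i :
  0 < e -> (forall t w, (1 <= t <= T)%N -> eta t w = e) ->
  measurable_fun [set: R] g -> (forall x, 0 <= x -> 0 <= g x) ->
  {ae P, forall w, forall r, infeasible_path eta w r ->
     expected_before k s q eta T.+1 w <= g (loss_before s T.+1 w i)} ->
  ('E_P[fun w => \sum_(1 <= t < T.+1) actual_loss k s q eta t w]%R <=
   'E_P[fun w => g (loss_before s T.+1 w i)]%R)%E.
Proof.
move=> e0 etaE; apply: expectation_path_bound => t.
- by move=> tT w; rewrite etaE.
- by move=> t1 tT w; rewrite !etaE// ?t1//= ltnW.
- move=> tT; rewrite (_ : eta t = cst e); first exact: measurable_cst.
  by apply/funext => w; exact: etaE.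
Qed.

(** A null set is not the whole space. This extracts the deterministic k_i <= L from the almost sure
    hypothesis of (1)(iii). *)
Lemma ae_const (Q : Prop) : {ae P, forall w, Q} -> Q.
Proof.
move=> [N [mN PN0 QN]]; apply: contrapT => nQ.
have NT : N = [set: Omega] by apply/seteqP; split=> // w _; exact: QN.
by have := probability_setT P; rewrite -NT PN0 => /eqP; rewrite eq_sym onee_eq0.
Qed.

End PathwiseReduction.

(** * Static and time-dependent rates *)

Section LearningRates.
Variables (R : realType) (n : option nat).
Variables (d : measure_display) (Omega : measurableType d).
Variable P : probability Omega R.
Variable k : expert n -> R.
Hypothesis k_ge0 : forall i, 0 <= k i.
Hypothesis k_kraft : (\esum_(i in [set: expert n]) (expR (- k i))%:E <= 1)%E.
Variables (T : nat) (q : nat -> expert n -> {RV P >-> R}).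
Hypothesis T_ge1 : (1 <= T)%N.
Hypothesis q_exp : perturbations T q.
Variable A : nat -> prod_space (nat * expert n) R -> prod_space (expert n) R.
Hypothesis A_adv : adversary T A.

Let s := losses A q.

Let u1T (eta : nat -> Omega -> R) (w : Omega) :=
  \sum_(1 <= t < T.+1) actual_loss k s q eta t w.

Implicit Types (eta : nat -> Omega -> R) (i : expert n).

Let l01 eta w t : (1 <= t <= T)%N -> 0 <= expected_loss k s q eta t w <= 1.
Proof. by move=> tT; exact: (expected_loss01 q_exp A_adv k eta tT). Qed.

Let TT : (1 <= T <= T)%N. Proof. by rewrite T_ge1 leqnn. Qed.

Lemma regret_static eta (L : R) : 0 < L ->
  (forall t w, (1 <= t <= T)%N -> eta t w = 1 / Num.sqrt L) ->
  {ae P, forall w, expected_before k s q eta T.+1 w <= L} ->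
  forall i, ('E_P[u1T eta] <=
    'E_P[(fun w => loss_before s T.+1 w i + Num.sqrt L * (k i + 1))%R])%E.
Proof.
move=> L0 etaE lL i; have sL : 0 < Num.sqrt L by rewrite sqrtr_gt0.
have e0 : 0 < 1 / Num.sqrt L by rewrite divr_gt0.
apply: (expectation_static_bound k_ge0 k_kraft q_exp A_adv
  (g := fun x => x + Num.sqrt L * (k i + 1)) e0 etaE).
- exact: measurable_funD.
- by move=> x x0; rewrite addr_ge0// mulr_ge0 ?addr_ge0// ltW.
move: lL; apply: filterS => w lL r [r01 lr /(_ T i TT) reg].
rewrite (etaE _ _ TT) in reg.
have := @static_regret _ T _ r _ (l01 eta w) lr _ L _ _ (fun t => @etaE t w) (ltW e0) lL reg.
move=> /le_trans; apply; rewrite -addrA lerD2l invf_div divr1.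
rewrite mulrDr mulr1 [_ * k i]mulrC lerD2l mul1r.
by rewrite -{2}(sqr_sqrtr (ltW L0)) expr2 mulrA mulVf ?mul1r// gt_eqF.
Qed.

Let sqrt_ratio (x y : R) : 0 < x -> 0 < y -> x / Num.sqrt (x / y) = Num.sqrt (y * x).
Proof.
move=> x0 y0; rewrite sqrtrM ?ltW// sqrtrV ?ltW// invf_div -{1}(sqr_sqrtr (ltW x0)).
rewrite sqrtrM ?ltW//.
by field; rewrite gt_eqF// sqrtr_gt0.
Qed.

Let sqrt_ratioM (x y : R) : 0 < x -> 0 < y -> Num.sqrt (x / y) * y = Num.sqrt (y * x).
Proof.
move=> x0 y0; rewrite sqrtrM ?ltW// sqrtrV ?ltW// -{2}(sqr_sqrtr (ltW y0)).
rewrite sqrtrM ?ltW//.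
by field; rewrite gt_eqF// sqrtr_gt0.
Qed.

Lemma regret_static_bounded eta (L K : R) : 0 < L -> 0 < K ->
  (forall i, k i <= K) ->
  (forall t w, (1 <= t <= T)%N -> eta t w = Num.sqrt (K / L)) ->
  {ae P, forall w, expected_before k s q eta T.+1 w <= L} ->
  forall i, ('E_P[u1T eta] <=
    'E_P[(fun w => loss_before s T.+1 w i + 2 * Num.sqrt (L * K))%R])%E.
Proof.
move=> L0 K0 kK etaE lL i.
have e0 : 0 < Num.sqrt (K / L) by rewrite sqrtr_gt0 divr_gt0.
apply: (expectation_static_bound k_ge0 k_kraft q_exp A_adv
  (g := fun x => x + 2 * Num.sqrt (L * K)) e0 etaE).
- exact: measurable_funD.
- by move=> x x0; rewrite addr_ge0// mulr_ge0 ?sqrtr_ge0.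
move: lL; apply: filterS => w lL r [r01 lr /(_ T i TT) reg].
rewrite (etaE _ _ TT) in reg.
have := @static_regret _ T _ r _ (l01 eta w) lr _ L _ _ (fun t => @etaE t w) (ltW e0) lL reg.
move=> /le_trans; apply.
have : k i / Num.sqrt (K / L) <= K / Num.sqrt (K / L).
  by rewrite ler_wpM2r// invr_ge0 ltW.
by rewrite sqrt_ratio// sqrt_ratioM//; lra.
Qed.

Lemma regret_static_complexity i eta (L : R) : 0 < k i ->
  (forall t w, (1 <= t <= T)%N -> eta t w = Num.sqrt (k i / L)) ->
  {ae P, forall w, Num.max (loss_before s T.+1 w i) (k i) <= L} ->
  ('E_P[u1T eta] <= 'E_P[(fun w => loss_before s T.+1 w i +
     2 * Num.sqrt (L * k i) + 3 * k i)%R])%E.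
Proof.
move=> k0 etaE sL.
have kL : k i <= L.
  apply: (ae_const (P := P)); move: sL; apply: filterS => w.
  by rewrite ge_max => /andP[].
have L0 : 0 < L by exact: lt_le_trans kL.
pose e := Num.sqrt (k i / L).
have e0 : 0 < e by rewrite sqrtr_gt0 divr_gt0.
have e1 : e <= 1 by rewrite -[leRHS]sqrtr1 ler_wsqrtr// ler_pdivrMr// mul1r.
apply: (expectation_static_bound k_ge0 k_kraft q_exp A_adv
  (g := fun x => x + 2 * Num.sqrt (L * k i) + 3 * k i) e0 etaE).
- by apply: measurable_funD => //; exact: measurable_funD.
- by move=> x x0; rewrite !addr_ge0// mulr_ge0 ?sqrtr_ge0.
move: sL; apply: filterS => w; rewrite ge_max => /andP[sL _] r [r01 lr /(_ T i TT) reg].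
rewrite (etaE _ _ TT) -/e in reg.
have := @static_regret_exp _ T _ r _ r01 lr _ (fun t => @etaE t w) (ltW e0) e1.
move=> /le_trans; apply.
have c0 : 0 <= 1 + e + e ^+ 2 by rewrite !addr_ge0 ?sqr_ge0// ltW.
apply: (le_trans (ler_wpM2l c0 reg)).
have keE : k i / e = Num.sqrt (L * k i) by exact: sqrt_ratio.
have eL : e * L = Num.sqrt (L * k i) by exact: sqrt_ratioM.
have eke : e * (k i / e) = k i by rewrite mulrCA divff ?mulr1// gt_eqF.
have e2L : e ^+ 2 * L = k i by rewrite sqr_sqrtr ?divr_ge0 ?ltW// divfK// gt_eqF.
have h1 := ler_wpM2l (ltW e0) sL.
have h2 := ler_wpM2l (sqr_ge0 e) sL.
have h3 : e * k i <= k i by rewrite ler_piMl// ltW.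
set S := loss_before s T.+1 w i in h1 h2 *.
(* Of the six products, S is kept, k_i / e and e S give at most 2 sqrt(L k_i), and each of the other
   three is at most k_i. *)
have -> : (1 + e + e ^+ 2) * (S + k i / e) =
  S + k i / e + e * S + e * (k i / e) + e ^+ 2 * S + e * (e * (k i / e)) by ring.
rewrite eke keE; lra.
Qed.

Let dynamic_regret_bound eta (C D : R) i : 0 < C ->
  (forall t w, (1 <= t <= T)%N -> eta t w = C / Num.sqrt t%:R) ->
  0 <= D -> k i / C + 2 * C <= D ->
  ('E_P[u1T eta] <= 'E_P[(fun w => loss_before s T.+1 w i + D * Num.sqrt T%:R)%R])%E.
Proof.
move=> C0 etaE D0 CD.
have sq t : (1 <= t)%N -> 0 < Num.sqrt t%:R :> R by move=> t1; rewrite sqrtr_gt0 ltr0n.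
apply: (expectation_path_bound k_ge0 k_kraft q_exp A_adv
  (g := fun x => x + D * Num.sqrt T%:R)).
- by move=> t tT w; rewrite etaE// divr_gt0// sq//; case/andP: tT.
- move=> t t1 tT w; rewrite !etaE ?t1//=; last exact: ltnW.
  rewrite ler_wpM2l ?(ltW C0)// lef_pV2 ?posrE ?sq// ler_wsqrtr//.
  by rewrite ler_nat.
- move=> t tT; rewrite (_ : eta t = cst (C / Num.sqrt t%:R)); first exact: measurable_cst.
  by apply/funext => w; exact: etaE.
- exact: measurable_funD.
- by move=> x x0; rewrite addr_ge0// mulr_ge0 ?sqrtr_ge0.
apply: aeW => w r [r01 lr /(_ T i TT) reg].
have := @dynamic_regret _ T _ r _ (l01 eta w) lr _ _ _ (fun t => @etaE t w) C0 T_ge1 reg.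
by move=> /le_trans; apply; rewrite lerD2l ler_wpM2r ?sqrtr_ge0.
Qed.

Lemma regret_dynamic eta :
  (forall t w, (1 <= t <= T)%N -> eta t w = 1 / Num.sqrt t%:R) ->
  forall i, ('E_P[u1T eta] <=
    'E_P[(fun w => loss_before s T.+1 w i + Num.sqrt T%:R * (k i + 2))%R])%E.
Proof.
move=> etaE i; rewrite [Num.sqrt _ * _]mulrC.
apply: (dynamic_regret_bound ltr01 etaE); last by rewrite divr1 mulr1.
by rewrite addr_ge0.
Qed.

Lemma regret_dynamic_bounded eta (K : R) : 0 < K -> (forall i, k i <= K) ->
  (forall t w, (1 <= t <= T)%N -> eta t w = Num.sqrt (K / (2 * t%:R))) ->
  forall i, ('E_P[u1T eta] <=
    'E_P[(fun w => loss_before s T.+1 w i + 2 * Num.sqrt (2 * T%:R * K))%R])%E.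
Proof.
move=> K0 kK etaE i.
have -> : 2 * Num.sqrt (2 * T%:R * K) = 2 * Num.sqrt (2 * K) * Num.sqrt T%:R.
  by rewrite [2 * T%:R * K]mulrAC sqrtrM ?mulr_ge0 ?(ltW K0)// mulrA.
(* C = sqrt(K / 2) balances K / C and 2 C, both equal to sqrt(2 K). *)
have C0 : 0 < Num.sqrt (K / 2) by rewrite sqrtr_gt0 divr_gt0.
apply: (dynamic_regret_bound C0).
- move=> t w tT; rewrite etaE// invfM mulrA sqrtrM ?divr_ge0 ?ltW// sqrtrV//.
- by rewrite mulr_ge0 ?sqrtr_ge0.
have : k i / Num.sqrt (K / 2) <= K / Num.sqrt (K / 2).
  by rewrite ler_wpM2r// invr_ge0 ltW.
by rewrite sqrt_ratio// [2 * Num.sqrt (K / 2)]mulrC sqrt_ratioM//; lra.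
Qed.

End LearningRates.

(** * Self-confident rates *)

Section SelfConfidentRates.
Variables (R : realType) (n : option nat).
Variables (d : measure_display) (Omega : measurableType d).
Variable P : probability Omega R.
Variable k : expert n -> R.
Hypothesis k_ge0 : forall i, 0 <= k i.
Hypothesis k_kraft : (\esum_(i in [set: expert n]) (expR (- k i))%:E <= 1)%E.
Variables (T : nat) (q : nat -> expert n -> {RV P >-> R}).
Hypothesis T_ge1 : (1 <= T)%N.
Hypothesis q_exp : perturbations T q.
Variable A : nat -> prod_space (nat * expert n) R -> prod_space (expert n) R.
Hypothesis A_adv : adversary T A.

Let s := losses A q.

Let u1T (eta : nat -> Omega -> R) (w : Omega) :=
  \sum_(1 <= t < T.+1) actual_loss k s q eta t w.

Implicit Types (eta : nat -> Omega -> R) (i : expert n).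

Let l01 eta w t : (1 <= t <= T)%N -> 0 <= expected_loss k s q eta t w <= 1.
Proof. by move=> tT; exact: (expected_loss01 q_exp A_adv k eta tT). Qed.

Let TT : (1 <= T <= T)%N. Proof. by rewrite T_ge1 leqnn. Qed.

Let expected_before_ge0 eta t w : (t <= T.+1)%N ->
  0 <= expected_before k s q eta t w.
Proof.
case: t => [_|t tT]; first by rewrite /expected_before big_geq.
by apply: (@sum_range_ge0 _ T) => // tau /(l01 eta w)/andP[].
Qed.

Let expected_before_mono eta t w : (1 <= t <= T)%N ->
  expected_before k s q eta t w <= expected_before k s q eta t.+1 w.
Proof.
move=> tT; have /andP[t1 _] := tT.
by rewrite /expected_before [leRHS]big_nat_recr//= lerDl; case/andP: (l01 eta w tT).
Qed.

Section ExplicitRate.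
Variables (eta : nat -> Omega -> R) (C : R).
Hypothesis C_gt0 : 0 < C.
Hypothesis etaE : forall t w, (1 <= t <= T)%N ->
  eta t w = C / Num.sqrt (expected_before k s q eta t w + 1).

Let root_gt0 t w : (t <= T.+1)%N ->
  0 < Num.sqrt (expected_before k s q eta t w + 1).
Proof.
by move=> tT; rewrite sqrtr_gt0 ltr_wpDl// expected_before_ge0.
Qed.

Lemma self_confident_gt0 t w : (1 <= t <= T)%N -> 0 < eta t w.
Proof.
by move=> tT; rewrite etaE// divr_gt0// root_gt0// ltnW// ltnS; case/andP: tT.
Qed.

(** The rates and the expected losses depend on each other: eta_t uses l_tau for tau < t, and l_tau
    is measurable from the past once eta_tau is. Hence the strong induction on t. *)
Lemma measurable_self_confident t : (1 <= t <= T)%N ->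
  measurable_fun [set: history q t] (eta t).
Proof.
elim/ltn_ind: t => t IH tT; have /andP[t1 tT'] := tT.
have mlb : measurable_fun [set: history q t] (fun w => expected_before k s q eta t w).
  rewrite (_ : (fun w => _) =
      (fun w => \sum_(tau < t.-1) expected_loss k s q eta tau.+1 w)); last first.
    by apply/funext => w; rewrite /expected_before big_add1 big_mkord.
  apply: measurable_sum => tau.
  have taut : (tau.+1 < t)%N by rewrite -ltn_predRL ltn_ord.
  have tauT : (1 <= tau.+1 <= T)%N by rewrite /= (leq_trans (ltnW taut)).
  apply: (@measurable_history_mono _ _ _ _ P q tau.+1) (ltnW taut) _.
  apply: (measurable_expected_loss q_exp A_adv k tauT).
    by move=> w; exact: self_confident_gt0.
  exact: IH.
rewrite (_ : eta t = fun w => C * (Num.sqrt (expected_before k s q eta t w + 1))^-1).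
  apply: measurable_funM => //; apply: measurable_inv_gt0.
    by move=> w; rewrite root_gt0// ltnW.
  apply: (measurableT_comp (@measurable_sqrt R)).
  exact: measurable_funD.
by apply/funext => w; exact: etaE.
Qed.

Lemma self_confident_bound (D : R) (g : R -> R) i : k i / C + 2 * C <= D ->
  measurable_fun [set: R] g -> (forall x, 0 <= x -> 0 <= g x) ->
  (forall x, 0 <= x -> x + D ^+ 2 + D * Num.sqrt (x + 1) <= g x) ->
  ('E_P[u1T eta] <= 'E_P[(fun w => g (loss_before s T.+1 w i))%R])%E.
Proof.
move=> CD mg g0 gD.
apply: (expectation_path_bound k_ge0 k_kraft q_exp A_adv (g := g)) => //.
- by move=> t tT w; exact: self_confident_gt0.
- move=> t t1 tT w; rewrite !etaE ?t1//=; last exact: ltnW.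
  have a1 : (t <= T.+1)%N := leqW (ltnW tT).
  have a2 : (t.+1 <= T.+1)%N := leqW tT.
  rewrite ler_wpM2l ?(ltW C_gt0)// lef_pV2 ?posrE ?root_gt0//.
  by rewrite ler_wsqrtr// lerD2r expected_before_mono// t1 ltnW.
- exact: measurable_self_confident.
apply: aeW => w r [r01 lr /(_ T i TT) reg].
apply: (le_trans _ (gD _ (loss_before_ge0 q A_adv w i (leqnn _)))).
apply: (@self_confident_regret _ T _ r _ (l01 eta w) lr C D _ (k i)
  (fun t => @etaE t w)) => //.
exact: (loss_before_ge0 q A_adv).
Qed.

End ExplicitRate.

Lemma regret_self_confident eta :
  (forall t w, (1 <= t <= T)%N ->
    eta t w = 1 / Num.sqrt (2 * (expected_before k s q eta t w + 1))) ->
  forall i, ('E_P[u1T eta] <=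
    'E_P[(fun w => loss_before s T.+1 w i +
       (k i + 1) * Num.sqrt (2 * (loss_before s T.+1 w i + 1)) +
       2 * (k i + 1) ^+ 2)%R])%E.
Proof.
move=> etaE i; have s2 : 0 < Num.sqrt 2 :> R by rewrite sqrtr_gt0.
have s22 : Num.sqrt 2 ^+ 2 = 2 :> R by rewrite sqr_sqrtr.
pose D := Num.sqrt 2 * (k i + 1).
have D2 : D ^+ 2 = 2 * (k i + 1) ^+ 2 by rewrite exprMn s22.
apply: (@self_confident_bound eta (Num.sqrt 2)^-1 _ _ D
  (fun x => x + (k i + 1) * Num.sqrt (2 * (x + 1)) + 2 * (k i + 1) ^+ 2) i).
- by rewrite invr_gt0.
- by move=> t w tT; rewrite etaE// sqrtrM// invfM mul1r.
- have -> : 2 * (Num.sqrt 2)^-1 = Num.sqrt 2 ^+ 2 * (Num.sqrt 2)^-1 :> R by rewrite s22.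
  rewrite invrK expr2 -mulrA divff ?gt_eqF// mulr1 /D.
  by rewrite mulrDr mulr1 [k i * _]mulrC.
- apply: measurable_funD => //; apply: measurable_funD => //.
  apply: measurable_funM => //; apply: measurable_fun_sqrt.
  by apply: measurable_funM => //; exact: measurable_funD.
- by move=> x x0; rewrite !addr_ge0// mulr_ge0 ?sqrtr_ge0 ?sqr_ge0// addr_ge0.
- move=> x x0; rewrite D2 sqrtrM// /D; lra.
Qed.

Lemma regret_self_confident_bounded eta (K : R) : 0 < K -> (forall i, k i <= K) ->
  (forall t w, (1 <= t <= T)%N ->
    eta t w = Num.sqrt (K / (2 * (expected_before k s q eta t w + 1)))) ->
  forall i, ('E_P[u1T eta] <=
    'E_P[(fun w => loss_before s T.+1 w i +
       2 * Num.sqrt (2 * (loss_before s T.+1 w i + 1) * K) + 8 * K)%R])%E.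
Proof.
move=> K0 kK etaE i; have C0 : 0 < Num.sqrt (K / 2) by rewrite sqrtr_gt0 divr_gt0.
(* With C = b / 2 both K / C and 2 C equal b, so D = 2 b and D^2 = 8 K is the additive constant. *)
pose b := Num.sqrt (2 * K).
have b0 : 0 <= b by exact: sqrtr_ge0.
have b2 : b ^+ 2 = 2 * K by rewrite sqr_sqrtr// mulr_ge0// ltW.
have Cb : 2 * Num.sqrt (K / 2) = b.
  have e2 : Num.sqrt (2 ^+ 2) = 2 :> R by rewrite sqrtr_sqr ger0_norm.
  rewrite /b -[X in X * _]e2 -sqrtrM ?sqr_ge0//.
  by congr Num.sqrt; field.
apply: (@self_confident_bound eta (Num.sqrt (K / 2)) _ _ (2 * b)
  (fun x => x + 2 * Num.sqrt (2 * (x + 1) * K) + 8 * K) i) => //.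
- by move=> t w tT; rewrite etaE// invfM mulrA sqrtrM ?divr_ge0 ?(ltW K0)// sqrtrV// addr_ge0 ?expected_before_ge0// ltnW// ltnS; case/andP: tT.
- have -> : Num.sqrt (K / 2) = b / 2 by rewrite -Cb; field.
  have bp : 0 < b by rewrite sqrtr_gt0 mulr_gt0.
  have kb : k i / (b / 2) <= K / (b / 2).
    by rewrite ler_wpM2r// invr_ge0 divr_ge0.
  have -> : 2 * (b / 2) = b by field.
  have -> : 2 * b = K / (b / 2) + b.
    have -> : K = b ^+ 2 / 2 by rewrite b2; field.
    by field; rewrite gt_eqF.
  by rewrite lerD2r.
- apply: measurable_funD => //; apply: measurable_funD => //.
  apply: measurable_funM => //; apply: measurable_fun_sqrt.
  apply: measurable_funM => //.
  by apply: measurable_funM => //; exact: measurable_funD.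
- by move=> x x0; rewrite !addr_ge0// mulr_ge0 ?sqrtr_ge0 ?(ltW K0).
- move=> x x0; rewrite exprMn b2 [2 * (x + 1) * K]mulrAC sqrtrM ?mulr_ge0 ?(ltW K0)// -/b.
  lra.
Qed.

End SelfConfidentRates.

(** * Rates depending on the best past loss *)

Section BestLossRates.
Variables (R : realType) (n : option nat).
Variables (d : measure_display) (Omega : measurableType d).
Variable P : probability Omega R.
Variable k : expert n -> R.
Hypothesis k_ge0 : forall i, 0 <= k i.
Hypothesis k_kraft : (\esum_(i in [set: expert n]) (expR (- k i))%:E <= 1)%E.
Variables (T : nat) (q : nat -> expert n -> {RV P >-> R}).
Hypothesis T_ge1 : (1 <= T)%N.
Hypothesis q_exp : perturbations T q.
Variable A : nat -> prod_space (nat * expert n) R -> prod_space (expert n) R.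
Hypothesis A_adv : adversary T A.

Let s := losses A q.

Let u1T (eta : nat -> Omega -> R) (w : Omega) :=
  \sum_(1 <= t < T.+1) actual_loss k s q eta t w.

Implicit Types (eta : nat -> Omega -> R) (i : expert n).

Let TT : (1 <= T <= T)%N. Proof. by rewrite T_ge1 leqnn. Qed.

Let loss_ge0 t w i : (t <= T.+1)%N -> 0 <= loss_before s t w i.
Proof. exact: (loss_before_ge0 q A_adv). Qed.

Let le_sqrtr2 (x y : R) : 0 <= y -> x <= y ^+ 2 -> Num.sqrt x <= y.
Proof.
by move=> y0 xy; rewrite -[leRHS](ger0_norm y0) -sqrtr_sqr ler_wsqrtr.
Qed.

Lemma regret_best_loss eta :
  (forall t w, (1 <= t <= T)%N ->
    eta t w = 1 / min_experts (fun i =>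
      k i + Num.sqrt (k i ^+ 2 + 2 * loss_before s t w i + 2))) ->
  forall i, ('E_P[u1T eta] <=
    'E_P[(fun w => loss_before s T.+1 w i +
       (k i + 2) * Num.sqrt (2 * loss_before s T.+1 w i) +
       2 * (k i + 2) ^+ 2)%R])%E.
Proof.
move=> etaE i0.
pose c t w i := k i + Num.sqrt (k i ^+ 2 + 2 * loss_before s t w i + 2).
pose y t w := min_experts (c t w).
have arg_ge0 t w i : (t <= T.+1)%N -> 0 <= k i ^+ 2 + 2 * loss_before s t w i + 2.
  by move=> tT; rewrite !addr_ge0 ?sqr_ge0// mulr_ge0 ?loss_ge0.
have c0 t w i : 0 <= c t w i by rewrite addr_ge0 ?sqrtr_ge0.
have s2 : 0 < Num.sqrt 2 :> R by rewrite sqrtr_gt0.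
have y0 t w : (t <= T.+1)%N -> 0 < y t w.
  move=> tT; apply: (lt_le_trans s2); apply: (le_min_experts i0) => i.
  rewrite /c -[leLHS]add0r lerD// ler_wsqrtr// lerDr addr_ge0 ?sqr_ge0//.
  by rewrite mulr_ge0 ?loss_ge0.
have y_mono t w : (1 <= t <= T)%N -> y t w <= y t.+1 w.
  move=> tT; apply: (le_min_experts i0) => i.
  apply: (@le_trans _ _ (c t w i)); first exact: min_experts_le.
  rewrite /c lerD2l ler_wsqrtr// lerD2r lerD2l ler_wpM2l//.
  by case/andP: (loss_before_step q A_adv w i tT).
have tT1 t : (1 <= t <= T)%N -> (t <= T.+1)%N by case/andP => _; exact: leqW.
have etaE' t w : (1 <= t <= T)%N -> eta t w = (y t w)^-1.
  by move=> tT; rewrite etaE// mul1r.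
(* This is the origin of the rate: c_i is the positive root of c^2 / 2 = s_i + 1 + k_i c, which
   turns r_{<t} <= s_i + k_i y_t into the requirement of [best_loss_regret]. *)
have c2 t w i : (t <= T.+1)%N ->
    c t w i ^+ 2 = 2 * (loss_before s t w i + 1 + k i * c t w i).
  move=> tT; have := sqr_sqrtr (arg_ge0 t w i tT).
  rewrite /c; set z := Num.sqrt _ => z2.
  have -> : (k i + z) ^+ 2 = k i ^+ 2 + 2 * k i * z + z ^+ 2 by ring.
  by rewrite z2; ring.
apply: (expectation_path_bound k_ge0 k_kraft q_exp A_adv
  (g := fun x => x + (k i0 + 2) * Num.sqrt (2 * x) + 2 * (k i0 + 2) ^+ 2)).
- by move=> t tT w; rewrite etaE'// invr_gt0 y0// tT1.
- move=> t t1 tT w; have tT' : (1 <= t <= T)%N by rewrite t1 ltnW.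
  rewrite !etaE'// lef_pV2 ?posrE ?y0 ?y_mono//; exact: tT1.
- move=> t tT; rewrite (_ : eta t = fun w => (y t w)^-1).
    apply: measurable_inv_gt0 => [w|]; first by rewrite y0// tT1.
    apply: (measurable_min_experts i0 (T := history q t)) => [w j //|j].
    apply: measurable_funD => //; apply: measurable_fun_sqrt.
    apply: measurable_funD => //; apply: measurable_funD => //.
    by apply: measurable_funM => //; apply: (measurable_loss_before A_adv); exact: tT1.
  by apply/funext => w; exact: etaE'.
- apply: measurable_funD => //; apply: measurable_funD => //.
  by apply: measurable_funM => //; apply: measurable_fun_sqrt; exact: measurable_funM.
- by move=> x x0; rewrite !addr_ge0// mulr_ge0 ?sqrtr_ge0 ?sqr_ge0// addr_ge0.
apply: aeW => w r [r01 lr reg].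
have b t : (1 <= t <= T)%N -> [/\ eta t w = (y t w)^-1, 0 < y t w &
    \sum_(1 <= tau < t) r tau + 1 <= y t w ^+ 2 / 2].
  move=> tT; split; [exact: etaE'|exact: y0 (tT1 _ tT)|].
  set S := \sum_(1 <= tau < t) r tau.
  have yt := y0 t w (tT1 _ tT).
  have S0 : 0 <= S.
    case: t tT @S yt => // t /andP[_ tT] S _.
    by apply: (@sum_range_ge0 _ T) => [|tau /r01/andP[]//]; exact: ltnW.
  (* The regret bound holds with the rate of round t - 1, and y increases; for t = 1 the sum is
     empty. *)
  have Sb i : S <= loss_before s t w i + k i * y t w.
    case: t tT @S yt S0 => // -[|t] tT S yt _.
      by rewrite /S big_geq// addr_ge0 ?loss_ge0// mulr_ge0// ltW.
    have tT' : (1 <= t.+1 <= T)%N by case/andP: tT => _ /ltnW.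
    apply: (le_trans (reg t.+1 i tT')); rewrite lerD2l etaE'// invrK.
    by rewrite ler_wpM2l// y_mono.
  (* The infimum is bounded below through each c_i, and squared only afterwards. *)
  suff : Num.sqrt (2 * (S + 1)) <= y t w.
    move=> h; have := sqr_sqrtr (_ : 0 <= 2 * (S + 1)).
    rewrite mulr_ge0 ?addr_ge0// => /(_ isT) e.
    have : Num.sqrt (2 * (S + 1)) ^+ 2 <= y t w ^+ 2.
      by rewrite lerXn2r// nnegrE ?sqrtr_ge0// ltW.
    by rewrite e; lra.
  apply: (le_min_experts i0) => i; apply: le_sqrtr2; first exact: c0.
  rewrite -/(c t w i) c2; last exact: tT1.
  rewrite ler_wpM2l// [leRHS]addrAC lerD2r (le_trans (Sb i))// lerD2l.
  by rewrite ler_wpM2l// min_experts_le.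
have L := @best_loss_regret _ T _ r _ r01 lr (y^~ w) b.
apply: (le_trans L).
set S := \sum_(1 <= t < T.+1) r t.
have S0 : 0 <= S by apply: (@sum_range_ge0 _ T) => // tau /r01/andP[].
have x0 := loss_ge0 w i0 (leqnn T.+1).
(* S <= x + k Y and sqrt(2 S) <= Y bound the total by x + (k + 2) Y, where x is the loss of [i0];
   then Y <= 2 k + 2 + sqrt(2 x). *)
pose Y := c T.+1 w i0.
have SY : S <= loss_before s T.+1 w i0 + k i0 * Y.
  apply: (le_trans (reg T i0 TT)); rewrite lerD2l etaE'// invrK ler_wpM2l//.
  by apply: (le_trans (y_mono T w TT)); exact: min_experts_le.
have Y0 : 0 <= Y by exact: c0.
have Y2 := c2 T.+1 w i0 (leqnn _); rewrite -/Y in Y2.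
have sSY : Num.sqrt (2 * S) <= Y.
  by apply: le_sqrtr2 => //; rewrite Y2 ler_wpM2l//; lra.
set x := loss_before s T.+1 w i0 in SY x0 Y2 *.
have k0 := k_ge0 i0.
have a0 := sqrtr_ge0 (2 * x).
have a2 : Num.sqrt (2 * x) ^+ 2 = 2 * x by rewrite sqr_sqrtr// mulr_ge0.
have Yb : Y <= 2 * k i0 + 2 + Num.sqrt (2 * x).
  have : Num.sqrt (k i0 ^+ 2 + 2 * x + 2) <= k i0 + 2 + Num.sqrt (2 * x).
    by apply: le_sqrtr2; nra.
  by rewrite /Y /c -/x; lra.
have k2 : 0 <= k i0 + 2 by lra.
have := ler_wpM2l k2 Yb.
nra.
Qed.

Lemma regret_best_loss_bounded eta (K : R) : 0 < K -> (forall i, k i <= K) ->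
  (forall t w, (1 <= t <= T)%N ->
    let smin := min_experts (loss_before s t w) in
    eta t w = Num.sqrt (1 / 2) *
      (if smin == 0 then 1 else Num.min 1 (Num.sqrt (K / smin)))) ->
  forall i, ('E_P[u1T eta] <=
    'E_P[(fun w => loss_before s T.+1 w i +
       2 * Num.sqrt (2 * K * loss_before s T.+1 w i) +
       5 * K * ln_pos (loss_before s T.+1 w i) + 3 * K + 6)%R])%E.
Proof.
move=> K0 kK etaE i0.
pose M t w := min_experts (loss_before s t w).
(* The inverse rate: the minimum turns into a maximum, and the convention for a zero best loss
   becomes automatic, the root being 0 there. *)
pose z t w := Num.sqrt 2 * Num.max 1 (Num.sqrt (M t w / K)).
have s2 : 0 < Num.sqrt 2 :> R by rewrite sqrtr_gt0.
have z0 t w : 0 < z t w by rewrite mulr_gt0// lt_max ltr01.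
have tT1 t : (1 <= t <= T)%N -> (t <= T.+1)%N by case/andP => _; exact: leqW.
have M0 t w : (t <= T.+1)%N -> 0 <= M t w.
  by move=> tT; apply: (le_min_experts i0) => i; exact: loss_ge0.
have M_le t w i : (t <= T.+1)%N -> M t w <= loss_before s t w i.
  by move=> tT; apply: min_experts_le => j; exact: loss_ge0.
have M_step w t : (1 <= t <= T)%N -> M t w <= M t.+1 w <= M t w + 1.
  move=> tT; have tT' : (t.+1 <= T.+1)%N by case/andP: tT.
  apply/andP; split.
    apply: (le_min_experts i0) => i; apply: (le_trans (M_le t w i (tT1 t tT))).
    by case/andP: (loss_before_step q A_adv w i tT).
  rewrite -lerBlDr; apply: (le_min_experts i0) => i.
  rewrite lerBlDr (le_trans (M_le t.+1 w i tT'))//.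
  by case/andP: (loss_before_step q A_adv w i tT).
have etaE' t w : (1 <= t <= T)%N -> eta t w = (z t w)^-1.
  move=> tT; rewrite etaE//= -/(M t w) /z mul1r sqrtrV// invfM; congr (_ * _).
  have := M0 t w (tT1 t tT); rewrite le_eqVlt => /predU1P[<-|Mp].
    by rewrite eqxx mul0r sqrtr0 max_l ?ler01// invr1.
  rewrite gt_eqF//.
  have -> : Num.sqrt (K / M t w) = (Num.sqrt (M t w / K))^-1.
    by rewrite -sqrtrV ?invf_div// divr_ge0// ltW.
  have a0 : 0 < Num.sqrt (M t w / K) by rewrite sqrtr_gt0 divr_gt0.
  have [a1|a1] := leP 1 (Num.sqrt (M t w / K)).
    by rewrite min_r// invf_le1.
  by rewrite min_l ?invr1// -[leLHS]invr1 lef_pV2 ?posrE// ltW.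
have z_mono w t : (1 <= t <= T)%N -> z t w <= z t.+1 w.
  move=> tT; rewrite ler_wpM2l ?sqrtr_ge0// ge_max le_max lexx /= le_max.
  by rewrite ler_wsqrtr ?orbT// ler_wpM2r ?invr_ge0 ?(ltW K0)//; case/andP: (M_step w t tT).
apply: (expectation_path_bound k_ge0 k_kraft q_exp A_adv
  (g := fun x => x + 2 * Num.sqrt (2 * K * x) + 5 * K * ln_pos x + 3 * K + 6)).
- by move=> t tT w; rewrite etaE'// invr_gt0.
- move=> t t1 tT w; have tT' : (1 <= t <= T)%N by rewrite t1 ltnW.
  by rewrite !etaE'// lef_pV2 ?posrE ?z_mono.
- move=> t tT; rewrite (_ : eta t = fun w => (z t w)^-1).
    apply: measurable_inv_gt0 => [w //|].
    apply: measurable_funM => //; apply: measurable_maxr => //.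
    apply: measurable_fun_sqrt; apply: measurable_funM => //.
    apply: (measurable_min_experts i0 (T := history q t)) => [w j|j].
      by rewrite loss_ge0// tT1.
    by apply: (measurable_loss_before A_adv); exact: tT1.
  by apply/funext => w; exact: etaE'.
- do 2! [apply: measurable_funD => //]; apply: measurable_funD.
    apply: measurable_funD => //; apply: measurable_funM => //.
    by apply: measurable_fun_sqrt; exact: measurable_funM.
  apply: measurable_funM => //; apply: (measurableT_comp (@measurable_ln R)).
  exact: measurable_maxr.
- move=> x x0; have : 0 <= ln_pos x by rewrite ln_ge0// le_max lexx.
  by move=> l0; rewrite !addr_ge0// mulr_ge0 ?sqrtr_ge0 ?mulr_ge0// ltW.
apply: aeW => w r [r01 lr reg].
apply: (@best_loss_log_regret _ T _ r (fun t => eta t w) (M^~ w) K) => //.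
- apply/eqP; rewrite eq_le M0// andbT (le_trans (M_le 1 w i0 _))//.
  by rewrite /loss_before big_geq.
- exact: M_step.
- exact: M_le.
- by move=> t tT; exact: etaE'.
(* Since k_i <= K, the penalty is uniform in i, and the infimum over the experts can be taken in the
   regret bound. *)
- move=> m mT; rewrite -lerBlDr; apply: (le_min_experts i0) => i.
  rewrite lerBlDr (le_trans (reg m i mT))// lerD2l etaE'// invrK.
  by rewrite ler_wpM2r// ltW.
Qed.

End BestLossRates.

Theorem corollary13 (R : realType) (n : option nat)
    (d : measure_display) (Omega : measurableType d) (P : probability Omega R)
    (k : expert n -> R) (k_ge0 : forall i, 0 <= k i)
    (k_kraft : (\esum_(i in [set: expert n]) (expR (- k i))%:E <= 1)%E)
    (T : nat) (T_ge1 : (1 <= T)%N)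
    (q : nat -> expert n -> {RV P >-> R}) (q_exp : perturbations T q)
    (A : nat -> prod_space (nat * expert n) R -> prod_space (expert n) R)
    (A_adv : adversary T A) :
  let s := losses A q in
  let s1T (i : expert n) (w : Omega) := loss_before s T.+1 w i in
  let ell_lt (eta : nat -> Omega -> R) (t : nat) (w : Omega) :=
    expected_before k s q eta t w in
  let ell1T (eta : nat -> Omega -> R) (w : Omega) := ell_lt eta T.+1 w in
  let u1T (eta : nat -> Omega -> R) (w : Omega) :=
    \sum_(1 <= t < T.+1) actual_loss k s q eta t w in
  (* (1)(i) *)
  (forall (eta : nat -> Omega -> R) (L : R), 0 < L ->
    (forall t w, (1 <= t <= T)%N -> eta t w = 1 / Num.sqrt L) ->
    {ae P, forall w, ell1T eta w <= L} ->
    forall i,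
    ('E_P[u1T eta] <= 'E_P[(fun w => s1T i w + Num.sqrt L * (k i + 1))%R])%E)
  /\
  (* (1)(ii) *)
  (forall (eta : nat -> Omega -> R) (L K : R), 0 < L -> 0 < K ->
    (forall i, k i <= K) ->
    (forall t w, (1 <= t <= T)%N -> eta t w = Num.sqrt (K / L)) ->
    {ae P, forall w, ell1T eta w <= L} ->
    forall i,
    ('E_P[u1T eta] <= 'E_P[(fun w => s1T i w + 2 * Num.sqrt (L * K))%R])%E)
  /\
  (* (1)(iii) *)
  (forall (i : expert n) (eta : nat -> Omega -> R) (L : R), 0 < k i ->
    (forall t w, (1 <= t <= T)%N -> eta t w = Num.sqrt (k i / L)) ->
    {ae P, forall w, Num.max (s1T i w) (k i) <= L} ->
    ('E_P[u1T eta]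
      <= 'E_P[(fun w => s1T i w + 2 * Num.sqrt (L * k i) + 3 * k i)%R])%E)
  /\
  (* (2)(i) *)
  (forall (eta : nat -> Omega -> R),
    (forall t w, (1 <= t <= T)%N -> eta t w = 1 / Num.sqrt t%:R) ->
    forall i,
    ('E_P[u1T eta] <= 'E_P[(fun w => s1T i w + Num.sqrt T%:R * (k i + 2))%R])%E)
  /\
  (* (2)(ii) *)
  (forall (eta : nat -> Omega -> R) (K : R), 0 < K ->
    (forall i, k i <= K) ->
    (forall t w, (1 <= t <= T)%N -> eta t w = Num.sqrt (K / (2 * t%:R))) ->
    forall i,
    ('E_P[u1T eta]
      <= 'E_P[(fun w => s1T i w + 2 * Num.sqrt (2 * T%:R * K))%R])%E)
  /\
  (* (3)(i) *)
  (forall (eta : nat -> Omega -> R),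
    (forall t w, (1 <= t <= T)%N ->
      eta t w = 1 / Num.sqrt (2 * (ell_lt eta t w + 1))) ->
    forall i,
    ('E_P[u1T eta]
      <= 'E_P[(fun w => s1T i w + (k i + 1) * Num.sqrt (2 * (s1T i w + 1))
                       + 2 * (k i + 1) ^+ 2)%R])%E)
  /\
  (* (3)(ii) *)
  (forall (eta : nat -> Omega -> R) (K : R), 0 < K ->
    (forall i, k i <= K) ->
    (forall t w, (1 <= t <= T)%N ->
      eta t w = Num.sqrt (K / (2 * (ell_lt eta t w + 1)))) ->
    forall i,
    ('E_P[u1T eta]
      <= 'E_P[(fun w => s1T i w + 2 * Num.sqrt (2 * (s1T i w + 1) * K)
                       + 8 * K)%R])%E)
  /\
  (* (4)(i) *)
  (forall (eta : nat -> Omega -> R),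
    (forall t w, (1 <= t <= T)%N ->
      eta t w = 1 / min_experts (fun i =>
        k i + Num.sqrt (k i ^+ 2 + 2 * loss_before s t w i + 2))) ->
    forall i,
    ('E_P[u1T eta]
      <= 'E_P[(fun w => s1T i w + (k i + 2) * Num.sqrt (2 * s1T i w)
                       + 2 * (k i + 2) ^+ 2)%R])%E)
  /\
  (* (4)(ii) *)
  (forall (eta : nat -> Omega -> R) (K : R), 0 < K ->
    (forall i, k i <= K) ->
    (forall t w, (1 <= t <= T)%N ->
      let smin := min_experts (loss_before s t w) in
      eta t w = Num.sqrt (1 / 2) *
        (if smin == 0 then 1 else Num.min 1 (Num.sqrt (K / smin)))) ->
    forall i,
    ('E_P[u1T eta]
      <= 'E_P[(fun w => s1T i w + 2 * Num.sqrt (2 * K * s1T i w)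
                       + 5 * K * ln_pos (s1T i w) + 3 * K + 6)%R])%E).
Proof.
cbv zeta; split; [|split; [|split; [|split; [|split; [|split; [|split; [|split]]]]]]].
- exact: regret_static.
- exact: regret_static_bounded.
- by move=> i eta L; exact: regret_static_complexity.
- exact: regret_dynamic.
- exact: regret_dynamic_bounded.
- exact: regret_self_confident.
- exact: regret_self_confident_bounded.
- exact: regret_best_loss.
- exact: regret_best_loss_bounded.
Qed.
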